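(* Consider the exponential family model with missing values and the variational Bayes procedure described in the context, with observed data $y_1,y_2,\dots$ generated under the true parameter value $\theta^*\in\Theta$. For large $n$ let $\tilde\theta_n$ be the equilibrium point of the iterative procedure, with $\tilde\theta_n=\Phi_n(\tilde\theta_n)$ and $\tilde\theta_n\to\theta^*$ with probability 1, and let $$q_n(\theta)=h(\tilde\alpha_n,\tilde\beta_n)\exp\{\theta^\top\tilde\beta_n-\tilde\alpha_n\psi(\theta)\},\qquad \tilde\alpha_n=n+\alpha_0,\quad \tilde\beta_n=\sum_{i=1}^n r_i(\tilde\theta_n)+\beta_0,$$ be the variational posterior density of $\theta$ at the equilibrium point. Let $\hat\theta_n$ maximise $\theta\mapsto\theta^\top\tilde\beta_n-\tilde\alpha_n\psi(\theta)$ over $\Theta$, and let $$\Sigma_n=\big[(n+\alpha_0)D^2\psi(\hat\theta_n)\big]^{-1}.$$ Then the variational posterior is asymptotically normal: $q_n$ converges in distribution to $\mathcal{N}(\hat\theta_n,\Sigma_n)$ as $n\to\infty$; that is, with probability 1, if $\theta$ is a random vector with density $q_n$, then $\Sigma_n^{-1/2}(\theta-\hat\theta_n)$ converges in distribution, as $n\to\infty$, to the standard normal distribution $\mathcal{N}(0,I_m)$ on $\mathbb{R}^m$.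
   Context: Model. $\Theta$ is an open subset of $\mathbb{R}^m$. For $\theta\in\Theta$, the pair $(x,y)$, with $x\in\mathbb{R}^d$ and $y\in\mathbb{R}^p$, has the density of natural exponential family form $$p(x,y|\theta)=f(x,y)\exp\{\theta^\top u(x,y)-\psi(\theta)\},$$ where $u$ takes values in $\mathbb{R}^m$ and $\psi:\Theta\to\mathbb{R}$ is six-times continuously differentiable with positive definite Hessian matrix $D^2\psi$ on $\Theta$. The parameter has the conjugate prior density $$p(\theta|\alpha_0,\beta_0)=h(\alpha_0,\beta_0)\exp\{\theta^\top\beta_0-\alpha_0\psi(\theta)\},\qquad \alpha_0\in\mathbb{R},\ \beta_0\in\mathbb{R}^m,$$ where in general $$h(\alpha,\beta)^{-1}=\int_\Theta\exp\{\theta^\top\beta-\alpha\psi(\theta)\}\,d\theta .$$ Data. Let $\theta^*\in\Theta$ be the true parameter value. The pairs $(x_1,y_1),(x_2,y_2),\dots$ are independent with density $p(\cdot,\cdot|\theta^* )$; only the $y_i$ are observed and the $x_i$ are missing. Thus $y_1,y_2,\dots$ are i.i.d. with density $\int p(x,y|\theta^* )\,dx$, and ''with probability 1'' refers to the law of this sequence. The sample of size $n$ is $(y_1,\dots,y_n)$. Iterative procedure. For $\theta\in\Theta$ and each $i$ let $$q_{x_i}(x_i)=f(x_i,y_i)\,g(\theta,y_i)\exp\{\theta^\top u(x_i,y_i)-\psi(\theta)\},\qquad g(\theta,y_i)^{-1}=\int f(x_i,y_i)\exp\{\theta^\top u(x_i,y_i)-\psi(\theta)\}\,dx_i,$$ and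 let $$r_i(\theta)=\int u(x_i,y_i)\,q_{x_i}(x_i)\,dx_i,\qquad \alpha=n+\alpha_0,\qquad \beta(\theta)=\sum_{i=1}^n r_i(\theta)+\beta_0 .$$ Define $$\Phi_n(\theta)=-\frac{D_\beta h(\alpha,\beta)}{h(\alpha,\beta)}\bigg|_{\beta=\beta(\theta)}=\int_\Theta \vartheta\, h(\alpha,\beta(\theta))\exp\{\vartheta^\top\beta(\theta)-\alpha\psi(\vartheta)\}\,d\vartheta ,$$ where $D_\beta$ denotes the gradient with respect to $\beta$. The variational Bayesian estimator is computed by starting with some initial value $\theta^{(0)}$ and iterating $\theta^{(k+1)}=\Phi_n(\theta^{(k)})$. An equilibrium point is a fixed point of $\Phi_n$; here $\tilde\theta_n$ is the equilibrium point to which the procedure converges from starting values near $\theta^*$. Conventions. It is implicitly assumed that the integrals above are finite, that differentiation under the integral sign is permitted, and that the iterates lie in $\Theta$, so that the procedure is well defined. *)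

(* Defs.v *)
From HB Require Import structures.
From mathcomp Require Import all_boot all_order all_algebra.
From mathcomp Require Import all_classical all_reals all_analysis.

Set Implicit Arguments.
Unset Strict Implicit.
Unset Printing Implicit Defensive.

Import Order.TTheory GRing.Theory Num.Theory.
Import numFieldNormedType.Exports.

Local Open Scope classical_set_scope.
Local Open Scope ring_scope.

Definition measure_row_display : measure_display -> measure_display.
Proof. exact. Qed.

Section measurable_row.
Context {d} {T : sigmaRingType d}.
Variable n : nat.

Let coors : 'I_n -> 'rV[T]_n -> T := fun i x => x ord0 i.

Let row_set0 : g_sigma_preimage coors set0.
Proof. exact: sigma_algebra0. Qed.

Let row_setC A : g_sigma_preimage coors A -> g_sigma_preimage coors (~` A).
Proof. exact: sigma_algebraC. Qed.

Let row_bigcup (F : (set 'rV[T]_n)^nat) :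
  (forall i, g_sigma_preimage coors (F i)) ->
  g_sigma_preimage coors (\bigcup_i (F i)).
Proof. exact: sigma_algebra_bigcup. Qed.

(* The product sigma-algebra; for T := R this is the Borel sigma-algebra. *)
HB.instance Definition _ := @isMeasurable.Build (measure_row_display d)
  'rV[T]_n (g_sigma_preimage coors) row_set0 row_setC row_bigcup.

End measurable_row.

Section measurable_row_theory.
Context d d1 (T : measurableType d) (T1 : measurableType d1).

Lemma measurable_row_coord n (i : 'I_n) :
  measurable_fun [set: 'rV[T]_n] (fun x : 'rV[T]_n => x ord0 i).
Proof.
move=> _ Y mY; rewrite setTI; apply: sub_sigma_algebra => /=.
rewrite -bigcup_seq/=; exists i => /=; first by rewrite mem_index_enum.
by exists Y => //; rewrite setTI.
Qed.

Lemma measurable_fun_row n (f : T1 -> 'rV[T]_n) :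
  (forall i, measurable_fun setT (fun t => f t ord0 i)) ->
  measurable_fun setT f.
Proof.
move=> mf; pose G := \big[setU/set0]_(i < n) preimage_set_system setT
  (fun x : 'rV[T]_n => x ord0 i) measurable.
apply: (@measurability _ _ _ _ setT f G).
  by [].
move=> _ [B + <-]; rewrite /G -bigcup_seq/= => -[i _ [C mC <-]].
rewrite !setTI -comp_preimage -[X in measurable X]setTI.
exact: (mf i).
Qed.

End measurable_row_theory.

Section lebesgue_row.
Context {R : realType}.

Definition row_cons n (p : R * 'rV[R]_n) : 'rV[R]_n.+1 :=
  @row_mx R 1 1 n (p.1)%:M p.2.

Definition row_uncons n (x : 'rV[R]_n.+1) : R * 'rV[R]_n :=
  (x ord0 ord0, \row_(j < n) x ord0 (lift ord0 j)).

Lemma row_consK n : cancel (@row_cons n) (@row_uncons n).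
Proof.
move=> [a x]; rewrite /row_cons /row_uncons /=; congr pair.
  have -> : (ord0 : 'I_n.+1) = lshift n (ord0 : 'I_1) by exact: val_inj.
  by apply: etrans (@row_mxEl R 1 1 n _ _ _ _) _; rewrite mxE.
apply/rowP => j; rewrite mxE.
have -> : lift ord0 j = rshift 1 j by exact: val_inj.
exact: (@row_mxEr R 1 1 n).
Qed.

Lemma measurable_row_cons n : measurable_fun setT (@row_cons n).
Proof.
apply: measurable_fun_row => i.
have [->|[j ->]] : i = ord0 \/ exists j, i = lift ord0 j.
- by case: (unliftP ord0 i) => [j ->|->]; [right; exists j|left].
- apply: (eq_measurable_fun fst) => // p _.
  by have := row_consK p => /(congr1 fst) /= ->.
- apply: (eq_measurable_fun (fun p : R * 'rV[R]_n => p.2 ord0 j)) => [p _|].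
    have := row_consK p => /(congr1 snd) /rowP/(_ j) /=.
    by rewrite mxE => ->.
  exact: (measurableT_comp (measurable_row_coord j) measurable_snd).
Qed.

Lemma measurable_row_uncons n : measurable_fun setT (@row_uncons n).
Proof.
apply/measurable_fun_pairP; split; first exact: measurable_row_coord.
apply: measurable_fun_row => i.
apply: (eq_measurable_fun (fun x : 'rV[R]_n.+1 => x ord0 (lift ord0 i))).
  by move=> x _; rewrite /= mxE.
exact: measurable_row_coord.
Qed.

Section step.
Variables (n : nat) (mu : {sigma_finite_measure set 'rV[R]_n -> \bar R}).

Definition lebesgue_row_step : set 'rV[R]_n.+1 -> \bar R :=
  pushforward (lebesgue_measure \x mu)%E (@row_cons n).

Let step0 : lebesgue_row_step set0 = 0%E.
Proof. by rewrite /lebesgue_row_step /pushforward preimage_set0 measure0. Qed.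

Let step_ge0 A : (0 <= lebesgue_row_step A)%E.
Proof. by rewrite /lebesgue_row_step /pushforward; exact: measure_ge0. Qed.

Let step_sigma_additive : semi_sigma_additive lebesgue_row_step.
Proof.
have mcons A : measurable A -> measurable (@row_cons n @^-1` A).
  by move=> mA; rewrite -[X in measurable X]setTI; exact: measurable_row_cons.
move=> F mF tF mUF; rewrite /lebesgue_row_step /pushforward preimage_bigcup.
apply: measure_semi_sigma_additive.
- by move=> k; exact: mcons.
- apply/trivIsetP => /= i j _ _ ij; rewrite -preimage_setI.
  by move/trivIsetP : tF => /(_ _ _ _ _ ij) ->//; rewrite preimage_set0.
- by rewrite -preimage_bigcup; exact: mcons.
Qed.

HB.instance Definition _ := isMeasure.Build _ _ _
  lebesgue_row_step step0 step_ge0 step_sigma_additive.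

Let sigma_finite_step : sigma_finite setT lebesgue_row_step.
Proof.
have /sigma_finiteP[F [TF ndF Foo]] := sigma_finiteT (@lebesgue_measure R).
have /sigma_finiteP[G [TG ndG Goo]] := sigma_finiteT mu.
exists (fun k => @row_uncons n @^-1` (F k `*` G k)).
  rewrite -preimage_bigcup -[LHS](preimage_setT (@row_uncons n)).
  congr (_ @^-1` _).
  rewrite -setXTT TF TG predeqE => -[x y]; split.
    move=> [/= [k _ Fkx] [l _ Gly]]; exists (maxn k l) => //; split.
    - by move: x Fkx; exact/subsetPset/ndF/leq_maxl.
    - by move: y Gly; exact/subsetPset/ndG/leq_maxr.
  by move=> [k _ []/= ? ?]; split; exists k.
move=> k; have [mF Fk] := Foo k; have [mG Gk] := Goo k; split.
  rewrite -[X in measurable X]setTI; apply: measurable_row_uncons => //.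
  exact: measurableX.
rewrite /lebesgue_row_step /pushforward -comp_preimage.
rewrite (_ : _ \o _ = id); last by apply/funext => p /=; rewrite row_consK.
rewrite (_ : id @^-1` _ = F k `*` G k)// product_measure1E//.
by rewrite lte_mul_pinfty// ge0_fin_numE.
Qed.

HB.instance Definition _ := Measure_isSigmaFinite.Build _ _ _
  lebesgue_row_step sigma_finite_step.
End step.

(* Lebesgue measure on R^n, as the n-fold product of Lebesgue measure on R. *)
Fixpoint lebesgue_row n : {sigma_finite_measure set 'rV[R]_n -> \bar R} :=
  match n with
  | 0 => \d_(0 : 'rV[R]_0)
  | n'.+1 => lebesgue_row_step (lebesgue_row n')
  end.

End lebesgue_row.

Section euclidean.
Context {R : realType} {m : nat}.
Implicit Types (f : 'rV[R]_m -> R) (D : set 'rV[R]_m) (A S : 'M[R]_m).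

Definition dot (a b : 'rV[R]_m) : R := \sum_(i < m) a ord0 i * b ord0 i.

Definition partial (i : 'I_m) f : 'rV[R]_m -> R := 'D_(delta_mx ord0 i) f.

Definition gradient f (x : 'rV[R]_m) : 'rV[R]_m := \row_i partial i f x.

Definition hessian f (x : 'rV[R]_m) : 'M[R]_m :=
  \matrix_(i, j) partial i (partial j f) x.

(* k times continuously differentiable on the (open) set D. *)
Fixpoint Ck (k : nat) D f : Prop :=
  (forall x, D x -> {for x, continuous f}) /\
  if k is k'.+1 then
    forall i : 'I_m, (forall x, D x -> derivable f x (delta_mx ord0 i)) /\
      Ck k' D (partial i f)
  else True.

Definition posdefmx A : Prop :=
  A^T = A /\ forall v : 'rV[R]_m, v != 0 -> 0 < dot (v *m A) v.

(* The positive definite square root; it exists and is unique when A is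
   positive definite. *)
Definition sqrtmx A : 'M[R]_m := get [set S | posdefmx S /\ S *m S = A].

(* The density of N(0, I_m). *)
Definition std_normal_pdf (x : 'rV[R]_m) : R :=
  (Num.sqrt (2 * pi)) ^- m * expR (- dot x x / 2).

End euclidean.

Section probability_notions.
Context {R : realType}.

(* The random vector X has density q with respect to Lebesgue measure on D
   (and vanishing density outside D). *)
Definition has_density d (T : measurableType d) (P : probability T R) n
    (X : {RV P >-> 'rV[R]_n}) (D : set 'rV[R]_n) (q : 'rV[R]_n -> \bar R) :=
  forall A, measurable A ->
    distribution P X A = (\int[lebesgue_row n]_(x in D `&` A) q x)%E.

Definition mutually_independent d (T : measurableType d) (P : probability T R)
    n (X : nat -> {RV P >-> 'rV[R]_n}) :=
  forall (I : seq nat) (A : nat -> set 'rV[R]_n), uniq I ->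
    (forall i, measurable (A i)) ->
    P (\bigcap_(i in [set` I]) (X i @^-1` A i)) =
    (\prod_(i <- I) P (X i @^-1` A i))%E.

(* Convergence in distribution of the random vectors Z n, each defined on its
   own probability space, to the law with density phi. *)
Definition cvg_in_distribution d (T : nat -> measurableType d)
    (P : forall n, probability (T n) R) k (Z : forall n, T n -> 'rV[R]_k)
    (phi : 'rV[R]_k -> R) :=
  forall g : 'rV[R]_k -> R, continuous g ->
    (exists M : R, forall x, `|g x| <= M) ->
    (\int[P n]_t (g (Z n t))%:E)%E @[n --> \oo] -->
    (\int[lebesgue_row k]_x (g x * phi x)%:E)%E.

End probability_notions.

(* The data of the model: the density of (x, y) given theta in Theta is
   f x y * exp (theta . u x y - psi theta), and the prior density of theta is
   proportional to exp (theta . beta0 - alpha0 * psi theta) on Theta. *)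
Record vb_model (R : realType) (m d p : nat) := VBModel {
  Theta : set 'rV[R]_m ;
  base : 'rV[R]_d -> 'rV[R]_p -> R ;
  suff : 'rV[R]_d -> 'rV[R]_p -> 'rV[R]_m ;
  psi : 'rV[R]_m -> R ;
  alpha0 : R ;
  beta0 : 'rV[R]_m }.

Section vb.
Context {R : realType} {m d p : nat} (M : vb_model R m d p).
Implicit Types (theta t beta : 'rV[R]_m) (alpha : R).

Definition joint_density theta (x : 'rV[R]_d) (y : 'rV[R]_p) : R :=
  base M x y * expR (dot theta (suff M x y) - psi M theta).

Definition observed_density theta (y : 'rV[R]_p) : \bar R :=
  (\int[lebesgue_row d]_x (joint_density theta x y)%:E)%E.

Definition conj_kernel alpha beta t : R :=
  expR (dot t beta - alpha * psi M t).

Definition conj_norm alpha beta : R :=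
  (\int[lebesgue_row m]_(t in Theta M) conj_kernel alpha beta t)^-1.

Definition conj_density alpha beta t : R :=
  conj_norm alpha beta * conj_kernel alpha beta t.

Definition latent_norm theta (y : 'rV[R]_p) : R :=
  (\int[lebesgue_row d]_x joint_density theta x y)^-1.

Definition q_latent theta (y : 'rV[R]_p) (x : 'rV[R]_d) : R :=
  base M x y * latent_norm theta y * expR (dot theta (suff M x y) - psi M theta).

Definition latent_mean theta (y : 'rV[R]_p) : 'rV[R]_m :=
  \row_j \int[lebesgue_row d]_x (suff M x y ord0 j * q_latent theta y x).

(* The sample of size n is y 0, ..., y (n - 1). *)
Variable y : nat -> 'rV[R]_p.

Definition post_alpha (n : nat) : R := n%:R + alpha0 M.

Definition post_beta (n : nat) theta : 'rV[R]_m :=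
  \sum_(i < n) latent_mean theta (y i) + beta0 M.

Definition Phi (n : nat) theta : 'rV[R]_m :=
  \row_j \int[lebesgue_row m]_(t in Theta M)
    (t ord0 j * conj_density (post_alpha n) (post_beta n theta) t).

(* One step of the procedure is well defined at theta: the integrals involved
   are finite, and h := conj_norm can be differentiated under the integral
   sign, so that Phi is also - D_beta h / h. *)
Definition vb_step_defined (n : nat) theta : Prop :=
  let alpha := post_alpha n in let beta := post_beta n theta in
  [/\ Theta M theta,
      forall i, (i < n)%N ->
        [/\ (lebesgue_row d).-integrable setT
              (fun x => (joint_density theta x (y i))%:E),
            0 < \int[lebesgue_row d]_x joint_density theta x (y i) &
            forall j, (lebesgue_row d).-integrable setT
              (fun x => (suff M x (y i) ord0 j *
                         joint_density theta x (y i))%:E)],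
      (lebesgue_row m).-integrable (Theta M)
        (fun t => (conj_kernel alpha beta t)%:E) /\
      forall j, (lebesgue_row m).-integrable (Theta M)
        (fun t => (t ord0 j * conj_kernel alpha beta t)%:E) &
      differentiable (conj_norm alpha) beta /\
      Phi n theta = - (conj_norm alpha beta)^-1 *: gradient (conj_norm alpha) beta].

(* t is an equilibrium point to which the procedure converges from all
   starting values near theta. *)
Definition vb_equilibrium (n : nat) theta t : Prop :=
  [/\ vb_step_defined n t, Phi n t = t &
      \forall t0 \near theta,
        (forall k, vb_step_defined n (iter k (Phi n) t0)) /\
        iter k (Phi n) t0 @[k --> \oo] --> t].

Definition maximises (F : 'rV[R]_m -> R) t : Prop :=
  Theta M t /\ forall t', Theta M t' -> F t' <= F t.

End vb.

(* Main.v *)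
Require Import Defs.
From HB Require Import structures.
From mathcomp Require Import all_boot all_order all_algebra.
From mathcomp Require Import all_classical all_reals all_analysis.
From mathcomp Require Import measurable_realfun ring lra.
From mathcomp Require complex.

(** The theorem is Laplace's method for the conjugate density
[exp (t . beta - alpha * psi t)] on [Theta], once its mode is known to converge
to [theta_star].

Writing [B a b] for the Bregman divergence [psi b - psi a - (b - a) . grad psi a],
the density around its mode [a] is proportional to [exp (- alpha * B a t)], because
[beta = alpha * grad psi a] there ([mode_stationary]). Since [psi] is the
logarithm of a partition function, it is convex along every segment whose
relevant points lie in [Theta] ([log_partition_convex]), even if [Theta] is not
convex. Positive definiteness of the Hessian at [theta_star] then makes [B a]
quadratic near [theta_star] and at least linearly growing on all of [Theta],
uniformly in [a] ([breg_growth]). In the coordinates [y] with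
[t = a + y Sigma^(1/2)] the exponent tends to [- |y|^2 / 2] ([bump_lim]) under the
majorant [exp (c0 - c1 |y|)] ([bump_le]), so integrals of bounded functions
converge ([laplace]). The Jacobian of the change of coordinates and the
normalising constant cancel in the quotient with the total mass
([whitened_expectation]).

Convergence of the mode follows from that of the equilibrium point, outcome by
outcome: an equilibrium point is the mean of the conjugate
density that it defines. If the exponent had a gradient [- alpha * v] with [|v|]
bounded below at the mean, the density would put almost all its first moment on
one side of it, which is impossible ([mean_gradient]). So [v] tends to 0, and
then the mode is close to the mean ([mode_near_mean]).

The measure-theoretic ingredients are the behaviour of Lebesgue measure under
linear maps, obtained from uniqueness of translation-invariant measures
([haar_unique]), and the existence of square roots of positive definite matrices
([posdef_sqrt_exists]). *)

Set Implicit Arguments.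
Unset Strict Implicit.
Unset Printing Implicit Defensive.

Import Order.TTheory GRing.Theory Num.Theory.
Import numFieldNormedType.Exports.

Local Open Scope classical_set_scope.
Local Open Scope ring_scope.

(** * Inner product, sup norm and positive definite matrices *)

Section dot_theory.
Context {R : realType} {m : nat}.
Implicit Types (a b c : 'rV[R]_m).

Lemma dotE a b : dot a b = (a *m b^T) ord0 ord0.
Proof. by rewrite mxE; apply: eq_bigr => i _; rewrite mxE. Qed.

Lemma dotC a b : dot a b = dot b a.
Proof. by apply: eq_bigr => i _; rewrite mulrC. Qed.

Lemma dotDl a b c : dot (a + b) c = dot a c + dot b c.
Proof. by rewrite /dot -big_split; apply: eq_bigr => i _; rewrite mxE mulrDl. Qed.

Lemma dotZl k a b : dot (k *: a) b = k * dot a b.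
Proof. by rewrite /dot mulr_sumr; apply: eq_bigr => i _; rewrite mxE mulrA. Qed.

Lemma dotNl a b : dot (- a) b = - dot a b.
Proof. by rewrite -scaleN1r dotZl mulN1r. Qed.

Lemma dotBl a b c : dot (a - b) c = dot a c - dot b c.
Proof. by rewrite dotDl dotNl. Qed.

Lemma dotDr a b c : dot a (b + c) = dot a b + dot a c.
Proof. by rewrite dotC dotDl !(dotC a). Qed.

Lemma dotZr k a b : dot a (k *: b) = k * dot a b.
Proof. by rewrite dotC dotZl (dotC a). Qed.

Lemma dotNr a b : dot a (- b) = - dot a b.
Proof. by rewrite dotC dotNl (dotC a). Qed.

Lemma dotBr a b c : dot a (b - c) = dot a b - dot a c.
Proof. by rewrite dotDr dotNr. Qed.

Lemma dot0l a : dot 0 a = 0.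
Proof. by rewrite /dot big1// => i _; rewrite mxE mul0r. Qed.

Lemma dot_mulmx a b (A : 'M[R]_m) : dot (a *m A) b = dot a (b *m A^T).
Proof. by rewrite !dotE trmx_mul trmxK mulmxA. Qed.

Lemma dot_ge0 a : 0 <= dot a a.
Proof. by apply: sumr_ge0 => i _; rewrite -expr2 sqr_ge0. Qed.

Lemma dot_eq0 a : (dot a a == 0) = (a == 0).
Proof.
apply/eqP/eqP => [/eqP|->]; last exact: dot0l.
rewrite psumr_eq0 => [/allP h|i _]; last by rewrite -expr2 sqr_ge0.
apply/rowP => i; rewrite mxE; apply/eqP.
by have := h i (mem_index_enum _); rewrite mulf_eq0 orbb.
Qed.

Lemma dot_gt0 a : a != 0 -> 0 < dot a a.
Proof. by move=> a0; rewrite lt_neqAle dot_ge0 andbT eq_sym dot_eq0. Qed.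

Lemma coord_le_norm a i : `|a ord0 i| <= `|a|.
Proof.
rewrite /Num.norm/= mx_normrE.
by apply: (le_bigmax _ (fun ij : 'I_1 * 'I_m => `|a ij.1 ij.2|) (ord0, i)).
Qed.

Lemma norm_le_coord a (k : R) : 0 <= k -> (forall i, `|a ord0 i| <= k) -> `|a| <= k.
Proof.
move=> k0 h; rewrite /Num.norm/= mx_normrE; apply: bigmax_le => // -[i j] _ /=.
by rewrite ord1.
Qed.

Lemma norm_le_dot a : `|a| ^+ 2 <= dot a a.
Proof.
have h : `|a| <= Num.sqrt (dot a a).
  apply: norm_le_coord => [|i]; first exact: sqrtr_ge0.
  rewrite -sqrtr_sqr ler_sqrt ?dot_ge0// /dot (bigD1 i)//= -expr2 lerDl.
  by apply: sumr_ge0 => j _; rewrite -expr2 sqr_ge0.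
by rewrite -[leRHS](sqr_sqrtr (dot_ge0 a)) lerXn2r ?nnegrE ?sqrtr_ge0.
Qed.

Lemma dot_le_norm a b : `|dot a b| <= m%:R * `|a| * `|b|.
Proof.
apply: le_trans (ler_norm_sum _ _ _) _.
apply: (@le_trans _ _ (\sum_(i < m) `|a| * `|b|)).
  by apply: ler_sum => i _; rewrite normrM ler_pM// coord_le_norm.
by rewrite sumr_const card_ord -mulrA mulr_natl.
Qed.

Lemma mulmx_le_norm a (A : 'M[R]_m) (e : R) : 0 <= e ->
  (forall i j, `|A i j| <= e) -> `|a *m A| <= m%:R * e * `|a|.
Proof.
move=> e0 h; apply: norm_le_coord => [|j]; first by rewrite !mulr_ge0.
rewrite mxE; apply: le_trans (ler_norm_sum _ _ _) _.
apply: (@le_trans _ _ (\sum_(i < m) `|a| * e)).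
  by apply: ler_sum => i _; rewrite normrM ler_pM// coord_le_norm.
by rewrite sumr_const card_ord -[in leRHS]mulrA mulr_natl [`|a| * e]mulrC.
Qed.

Lemma quad_le_norm a (A : 'M[R]_m) (e : R) : 0 <= e ->
  (forall i j, `|A i j| <= e) -> `|dot (a *m A) a| <= m%:R ^+ 2 * e * `|a| ^+ 2.
Proof.
move=> e0 h; apply: le_trans (dot_le_norm _ _) _.
rewrite [leRHS](_ : _ = m%:R * (m%:R * e * `|a|) * `|a|); last by ring.
by rewrite ler_wpM2r// ler_wpM2l// mulmx_le_norm.
Qed.

Lemma entries_bounded (A : 'M[R]_m) :
  exists2 e : R, 0 <= e & forall i j, `|A i j| <= e.
Proof.
exists (\sum_i \sum_j `|A i j|) => [|i j].
  by apply: sumr_ge0 => i _; apply: sumr_ge0.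
rewrite (bigD1 i)//= (bigD1 j)//= -addrA lerDl addr_ge0//.
  by apply: sumr_ge0.
by apply: sumr_ge0 => k _; apply: sumr_ge0.
Qed.

End dot_theory.

Section posdef.
Import complex.
Context {R : realType}.

Lemma posdefmx_unit m (A : 'M[R]_m) : posdefmx A -> A \in unitmx.
Proof.
move=> [_ pA]; rewrite -row_free_unit -kermx_eq0.
apply/eqP/row_matrixP => i; rewrite row0; apply/eqP/negPn/negP => /pA.
by rewrite -row_mul mulmx_ker row0 dot0l ltxx.
Qed.

(** Induction on the list of nodes: a new node [a] is adjusted by a multiple of
the product of the [X - b] over the old nodes [b], which vanishes at them. *)
Lemma interpolation (F : fieldType) (s : seq F) (f : F -> F) :
  exists p : {poly F}, {in s, forall x, p.[x] = f x}.
Proof.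
elim: s => [|a s [p ps]]; first by exists 0.
have [sa|sa] := boolP (a \in s).
  by exists p => x; rewrite inE => /predU1P[->|]; exact: ps.
pose w := \prod_(b <- s) ('X - b%:P).
have wa : w.[a] != 0 by rewrite -rootE root_prod_XsubC.
exists (p + ((f a - p.[a]) / w.[a]) *: w) => x; rewrite inE => /predU1P[->|xs].
  by rewrite !hornerE divfK// addrC subrK.
have /eqP wx : w.[x] == 0 by rewrite -rootE root_prod_XsubC.
by rewrite !hornerE wx mulr0 addr0 ps.
Qed.

Lemma trmx_horner m (A : 'M[R]_m.+1) p : A^T = A ->
  (horner_mx A p)^T = horner_mx A p.
Proof.
move=> sA; elim/poly_ind: p => [|p c ih]; first by rewrite rmorph0 trmx0.
rewrite rmorphD rmorphM/= horner_mx_X horner_mx_C linearD/= tr_scalar_mx.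
congr (_ + _); rewrite -mulmxE trmx_mul ih sA.
exact: (comm_mx_horner p (erefl (A *m A))).
Qed.

(** The square root is a real polynomial in [A]: complex diagonalization gives
real positive eigenvalues, and [p] interpolates the fourth root on them, so
that [T := p(A)] is symmetric and satisfies [T^4 = A]. Then [T^2] is the root,
and it is positive definite because it is the square of the invertible
symmetric matrix [T]. The coefficients of [p] are real, so all of this
takes place over the reals. *)
Lemma posdef_sqrt_exists m (A : 'M[R]_m) : posdefmx A ->
  exists S, posdefmx S /\ S *m S = A.
Proof.
case: m A => [|m] A [sA pA].
  exists A; split; last by apply/matrixP => -[].
  by split => // v; rewrite [v]thinmx0 eqxx.
pose C : numClosedFieldType := (complex R).
pose toC : {rmorphism R -> C} := real_complex_def (Phant R).
pose AC : 'M[C]_m.+1 := map_mx toC A.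
have realAC : AC \is a mxOver (@Num.real C).
  by apply/mxOverP => i j; rewrite mxE complex_real.
have hAC : AC \is hermsymmx.
  apply: realsym_hermsym => //; apply/is_hermitianmxP.
  by rewrite expr0 scale1r map_mx_id// /AC map_trmx sA.
have nAC := hermitian_normalmx hAC.
have /orthomx_spectralP := nAC; set P := spectralmx AC; set d := spectral_diag AC.
move=> ACE.
have uP : P \in unitmx := spectral_unit AC.
have PAC : P *m AC = diag_mx d *m P by rewrite {1}ACE !mulmxA mulmxV// mul1mx.
have dreal i : exists r : R, 0 < r /\ d ord0 i = toC r.
  have := hermitian_spectral_diag_real hAC.
  move=> /mxOverP/(_ ord0 i); rewrite -/d => di.
  have [r dr] : exists r : R, d ord0 i = toC r.
    by move/RRe_real : di => <-; eexists.
  exists r; split => //.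
  have ev : eigenvalue AC (toC r).
    apply/eigenvalueP; exists (row i P).
      rewrite -row_mul PAC row_mul row_diag_mx -dr -scalemxAl -rowE.
      by [].
    apply/eqP => Pi0; have : row i (P *m invmx P) = 0 by rewrite row_mul Pi0 mul0mx.
    rewrite mulmxV// => /rowP/(_ i); rewrite !mxE eqxx => /eqP.
    by rewrite oner_eq0.
  have : eigenvalue A r.
    by move: ev; rewrite !eigenvalue_root_char -map_char_poly fmorph_root.
  move=> /eigenvalueP[v vA v0].
  have := pA v v0; rewrite vA dotZl pmulr_lgt0//; exact: dot_gt0.
have [rs rsP] := choice dreal.
(* the fourth root, so that T *m T is a square of a symmetric matrix *)
have [p pP] := interpolation [seq rs i | i : 'I_m.+1] (fun x => Num.sqrt (Num.sqrt x)).
pose T := horner_mx A p.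
have sT : T^T = T by exact: trmx_horner.
have TTTT : (T *m T) *m (T *m T) = A.
  have q0 : horner_mx A (p ^+ 4 - 'X) = 0.
    apply: (@map_mx_inj _ _ toC).
    rewrite map_horner_mx map_mx0 -/AC ACE.
    rewrite (horner_mx_uconjC _ _ uP) horner_mx_diag.
    rewrite (_ : map_mx _ d = 0); first by rewrite linear0 mulmx0 mul0mx.
    apply/rowP => i; rewrite !mxE.
    have [r0 ->] := rsP i.
    rewrite horner_map/= !hornerE pP; last by rewrite map_f// mem_enum.
    rewrite -[4%N]/(2 * 2)%N exprM !sqr_sqrtr ?sqrtr_ge0 ?(ltW r0)//.
    by rewrite subrr rmorph0.
  move: q0; rewrite rmorphB rmorphXn/= horner_mx_X => /eqP.
  by rewrite subr_eq0 => /eqP <-; rewrite -/T !exprS expr0 mulr1 -!mulmxE !mulmxA.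
exists (T *m T); split => //; split; first by rewrite trmx_mul sT.
move=> v v0; rewrite mulmxA dot_mulmx sT; apply: dot_gt0.
apply: contra_neq v0 => vT0.
have uA : A \in unitmx by exact: posdefmx_unit.
have : v *m A = 0 by rewrite -TTTT !mulmxA vT0 !mul0mx.
by move=> /(congr1 (mulmx^~ (invmx A))); rewrite mulmxK// mul0mx.
Qed.

Lemma sqrtmxP m (A : 'M[R]_m) : posdefmx A ->
  posdefmx (sqrtmx A) /\ sqrtmx A *m sqrtmx A = A.
Proof.
move=> /posdef_sqrt_exists[S hS].
exact: (@getPex _ [set S | posdefmx S /\ S *m S = A] (ex_intro _ S hS)).
Qed.

(** With [S] a symmetric square root of [A], the quadratic form at [v] is the
squared length of [v S], and [v = (v S) S^-1] is bounded by a multiple of it. *)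
Lemma posdefmx_coercive m (A : 'M[R]_m) : posdefmx A ->
  exists2 k : R, 0 < k & forall v, k * dot v v <= dot (v *m A) v.
Proof.
move=> /posdef_sqrt_exists[S [pS SS]].
have uS := posdefmx_unit pS.
have [sS _] := pS.
have [e e0 eP] := entries_bounded (invmx S).
pose c := m%:R ^+ 3 * e ^+ 2 + 1.
have c0 : 0 < c by rewrite ltr_wpDl// mulr_ge0// exprn_ge0.
exists c^-1 => [|v]; first by rewrite invr_gt0.
rewrite -SS mulmxA dot_mulmx sS; set w := v *m S.
have -> : v = w *m invmx S by rewrite mulmxK.
rewrite mulrC ler_pdivrMr// [leRHS]mulrC.
apply: le_trans (ler_norm _) _; apply: le_trans (dot_le_norm _ _) _.
rewrite -mulrA -expr2.
apply: (@le_trans _ _ (m%:R * (m%:R * e * `|w|) ^+ 2)).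
  by rewrite ler_wpM2l// lerXn2r ?nnegrE// ?mulr_ge0// mulmx_le_norm.
apply: (@le_trans _ _ (c * `|w| ^+ 2)).
  rewrite (_ : m%:R * _ = m%:R ^+ 3 * e ^+ 2 * `|w| ^+ 2); last by ring.
  by rewrite ler_wpM2r ?sqr_ge0// lerDl.
by rewrite ler_wpM2l ?(ltW c0)// norm_le_dot.
Qed.

End posdef.

(** * The Borel sigma-algebra of row vectors *)

Section row_measurability.
Context {R : realType} {m : nat}.

Lemma measurable_row_fun d (T : measurableType d) (f : T -> 'rV[R]_m) (i : 'I_m) :
  measurable_fun setT f -> measurable_fun setT (fun t => f t ord0 i).
Proof.
move=> mf; exact: (measurableT_comp (measurable_row_coord i) mf).
Qed.

Lemma measurable_rowD d (T : measurableType d) (f g : T -> 'rV[R]_m) :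
  measurable_fun setT f -> measurable_fun setT g ->
  measurable_fun setT (fun t => f t + g t).
Proof.
move=> mf mg; apply: measurable_fun_row => i.
under eq_fun do rewrite mxE.
by apply: measurable_funD; exact: measurable_row_fun.
Qed.

Lemma measurable_rowM d (T : measurableType d) (f : T -> 'rV[R]_m) (A : 'M[R]_m) :
  measurable_fun setT f -> measurable_fun setT (fun t => f t *m A).
Proof.
move=> mf; apply: measurable_fun_row => i.
under eq_fun do rewrite mxE.
apply: measurable_sum => j; apply: measurable_funM => //.
exact: measurable_row_fun.
Qed.

Lemma measurable_rowN d (T : measurableType d) (f : T -> 'rV[R]_m) :
  measurable_fun setT f -> measurable_fun setT (fun t => - f t).
Proof.
move=> mf; apply: measurable_fun_row => i.
under eq_fun do rewrite mxE.
by apply: measurableT_comp => //; exact: measurable_row_fun.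
Qed.

Lemma measurable_rowB d (T : measurableType d) (f g : T -> 'rV[R]_m) :
  measurable_fun setT f -> measurable_fun setT g ->
  measurable_fun setT (fun t => f t - g t).
Proof.
by move=> mf mg; apply: measurable_rowD => //; exact: measurable_rowN.
Qed.

Lemma measurable_dot d (T : measurableType d) (f g : T -> 'rV[R]_m) :
  measurable_fun setT f -> measurable_fun setT g ->
  measurable_fun setT (fun t => dot (f t) (g t)).
Proof.
move=> mf mg; apply: measurable_sum => j.
by apply: measurable_funM; exact: measurable_row_fun.
Qed.

Lemma norm_leP (x : 'rV[R]_m) (k : R) : 0 <= k ->
  (`|x| <= k) = [forall i, `|x ord0 i| <= k].
Proof.
move=> k0; apply/idP/forallP => [h i|]; last exact: norm_le_coord.
by apply: le_trans h; exact: coord_le_norm.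
Qed.

Lemma measurable_norm_le (k : R) : measurable [set x : 'rV[R]_m | `|x| <= k].
Proof.
have [k0|k0] := ltP k 0.
  rewrite (_ : mkset _ = set0)//; apply/seteqP; split => // x /= h.
  by have := le_lt_trans h k0; rewrite normr_lt0.
rewrite (_ : mkset _ = \bigcap_(i in [set: 'I_m])
    ((fun x : 'rV[R]_m => x ord0 i) @^-1` [set r : R | `|r| <= k])).
  apply: fin_bigcap_measurable => // i _; rewrite -[X in measurable X]setTI.
  apply: measurable_row_coord => //.
  rewrite (_ : mkset _ = `[-k, k]%classic)//.
  by apply/seteqP; split => r /=; rewrite in_itv/= ler_norml.
apply/seteqP; split => x /=; rewrite norm_leP//.
  by move=> /forallP h i _; exact: h.
by move=> h; apply/forallP => i; exact: h.
Qed.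

(** The sup norm makes balls into boxes, and an open set is the union of the
countably many boxes with rational centre and radius [1/(k+1)] inside it. *)
Lemma measurable_row_open (U : set 'rV[R]_m) : open U -> measurable U.
Proof.
move=> oU.
pose q (r : 'rV[rat]_m) : 'rV[R]_m := map_mx ratr r.
pose B (rk : 'rV[rat]_m * nat) : set 'rV[R]_m := [set x | `|x - q rk.1| <= rk.2.+1%:R^-1].
rewrite (_ : U = \bigcup_(rk in [set rk | B rk `<=` U]) B rk).
  rewrite bigcup_mkcond; apply: countable_bigcupT_measurable => [|rk].
    exact: countableP.
  case: ifP => // _; rewrite /B.
    rewrite -[X in measurable X]setTI.
    apply: (measurable_rowB _ _ measurableT (measurable_norm_le _)) => //.
apply/seteqP; split => [x Ux|x [rk rkU Bx]]; last exact: rkU Bx.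
have /nbhs_ballP[e /= e0 xe] : nbhs x U by exact: open_nbhs_nbhs.
have [k ke] : exists k : nat, k.+1%:R^-1 < e / 2.
  have [k _ /(_ _ (leqnn k)) h] := near_infty_natSinv_lt (PosNum (divr_gt0 e0 (ltr0Sn R 1))).
  by exists k.
have [r rP] : exists r : 'rV[rat]_m, forall i, `|x ord0 i - ratr (r ord0 i)| < k.+1%:R^-1.
  have h i : exists s : rat, `|x ord0 i - ratr s| < k.+1%:R^-1.
    have [|s] := @rat_in_itvoo R (x ord0 i) (x ord0 i + k.+1%:R^-1).
      by rewrite ltrDl invr_gt0.
    rewrite in_itv/= => /andP[s1 s2]; exists s.
    by rewrite distrC ger0_norm ?subr_ge0 ?(ltW s1)// ltrBlDl.
  have [s sP] := choice h.
  by exists (\row_i s i) => i; rewrite mxE.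
have xB : B (r, k) x.
  apply: norm_le_coord => [|i]; first by rewrite invr_ge0.
  by rewrite !mxE ltW.
exists (r, k) => //= y By; apply: xe.
rewrite -ball_normE/=.
rewrite -(subrKA (q r)) (le_lt_trans (ler_normD _ _))//.
rewrite (splitr e) ltrD//; first exact: le_lt_trans xB ke.
by rewrite distrC; exact: le_lt_trans By ke.
Qed.

Lemma continuous_row_measurable (f : 'rV[R]_m -> R) : continuous f ->
  measurable_fun setT f.
Proof.
move=> cf; apply: (measurability _ (RGenOpens.measurableE R)).
move=> _ [_ [a [b ->] <-]]; rewrite setTI.
apply: measurable_row_open; apply: open_comp => // x _; exact: cf.
Qed.

End row_measurability.

(** * Lebesgue measure on row vectors: translations, products, linear maps *)

Section lebesgue1.
Context {R : realType}.
Local Notation mu := (@lebesgue_measure R).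

Lemma ge0_integral_translation1 (f : R -> \bar R) (a : R) :
  measurable_fun setT f -> (forall x, 0 <= f x)%E ->
  (\int[mu]_x f (x + a)%R = \int[mu]_x f x)%E.
Proof.
move=> mf f0.
pose g : measurableTypeR R -> measurableTypeR R := fun x => x + a.
have mg : measurable_fun setT g by exact: measurable_funD.
pose gm := isMeasurableFun.Build _ _ _ _ g mg.
pose gp : {mfun (measurableTypeR R) >-> (measurableTypeR R)} := HB.pack g gm.
have -> : (\int[mu]_x f (x + a)%R = \int[pushforward mu gp]_x f x)%E.
  by rewrite ge0_integral_pushforward.
apply: eq_measure_integral => A mA _; apply/esym.
apply: (@lebesgue_measure_unique R (pushforward mu gp)) => // X [[x y] _ <-].
rewrite [RHS](_ : _ = mu `](x - a), (y - a)]%classic).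
  rewrite !lebesgue_measure_itv/= !lte_fin ltrD2r.
  by case: ifP => // _; rewrite -!EFinB; congr EFin; ring.
rewrite /pushforward; congr (mu _).
by apply/seteqP; split => z /=; rewrite !in_itv/= ltrBlDr lerBrDr.
Qed.

End lebesgue1.

Section lebesgue_row_theory.
Context {R : realType}.
Local Notation mu := (@lebesgue_measure R).
Local Notation lam n := (@lebesgue_row R n).
Local Open Scope ereal_scope.

Lemma ge0_integral_rowS n (f : 'rV[R]_n.+1 -> \bar R) :
  measurable_fun setT f -> (forall x, 0 <= f x) ->
  \int[lam n.+1]_x f x = \int[mu]_a \int[lam n]_x f (row_cons (a, x)).
Proof.
move=> mf f0.
have mc : measurable_fun setT
    (@row_cons R n : (measurableTypeR R * 'rV[R]_n)%type -> 'rV[R]_n.+1).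
  exact: measurable_row_cons.
have H := ge0_integral_pushforward mc (lebesgue_measure \x lam n)%E
  measurableT mf (fun x _ => f0 x).
rewrite [LHS]H /= preimage_setT {H}.
by rewrite fubini_tonelli1//=; exact: measurableT_comp.
Qed.

Lemma row_cons_head n (p : R * 'rV[R]_n) : row_cons p ord0 ord0 = p.1.
Proof. by have /(congr1 fst) := row_consK p. Qed.

Lemma row_cons_tail n (p : R * 'rV[R]_n) j : row_cons p ord0 (lift ord0 j) = p.2 ord0 j.
Proof. by have /(congr1 snd)/rowP/(_ j) := row_consK p; rewrite mxE. Qed.

Lemma row_consD n a b (x y : 'rV[R]_n) :
  (row_cons (a, x) + row_cons (b, y))%R = row_cons ((a + b)%R, (x + y)%R).
Proof.
apply/rowP => i; rewrite mxE; case: (unliftP ord0 i) => [j ->|->].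
  by rewrite !row_cons_tail mxE.
by rewrite !row_cons_head.
Qed.

Lemma row_uncons_cons n (x : 'rV[R]_n.+1) : row_cons (row_uncons x) = x.
Proof.
apply/rowP => i; case: (unliftP ord0 i) => [j ->|->].
  by rewrite row_cons_tail mxE.
by rewrite row_cons_head.
Qed.

Lemma ge0_integral_translation n (f : 'rV[R]_n -> \bar R) (a : 'rV[R]_n) :
  measurable_fun setT f -> (forall x, 0 <= f x) ->
  \int[lam n]_x f (x + a)%R = \int[lam n]_x f x.
Proof.
elim: n f a => [|n ih] f a mf f0.
  by apply: eq_integral => x _; rewrite [(x + a)%R]thinmx0 [x]thinmx0.
have mT : measurable_fun setT (fun x : 'rV[R]_n.+1 => x + a)%R.
  exact: measurable_rowD.
have mcons : measurable_fun setT (fun p : R * 'rV[R]_n => f (row_cons p)).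
  by apply: measurableT_comp => //; exact: measurable_row_cons.
rewrite !ge0_integral_rowS//; last exact: measurableT_comp.
pose b := (row_uncons a).1; pose c := (row_uncons a).2.
transitivity (\int[mu]_t \int[lam n]_x f (row_cons (t + b, x)%R)).
  apply: eq_integral => t _.
  rewrite -(ih (fun x => f (row_cons ((t + b)%R, x))) c)//.
    apply: eq_integral => x _.
    by rewrite -[a in LHS]row_uncons_cons [row_uncons a]surjective_pairing row_consD.
  by apply: measurableT_comp mcons _; exact: measurable_pair1.
rewrite (ge0_integral_translation1 (f := fun t => \int[lam n]_x f (row_cons (t, x))))//.
  exact: (measurable_fun_fubini_tonelli_F (fun p => f (row_cons p))).
by move=> t; exact: integral_ge0.
Qed.

Lemma ge0_integral_row_prod n (f : R -> R) (c : R) :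
  measurable_fun setT f -> (forall x, 0 <= f x)%R ->
  \int[mu]_x (f x)%:E = c%:E ->
  \int[lam n]_x (\prod_(i < n) f (x ord0 i))%:E = (c ^+ n)%:E.
Proof.
move=> mf f0 fc; elim: n => [|n ih].
  rewrite (eq_integral (cst 1)) => [|x _]; last by rewrite big_ord0.
  by rewrite integral_cst//= diracT mul1e.
have mp k : measurable_fun setT (fun x : 'rV[R]_k => (\prod_(i < k) f (x ord0 i))%:E).
  apply/measurable_EFinP; apply: measurable_prod => i _.
  exact: (measurableT_comp mf (measurable_row_coord i)).
have p0 k (x : 'rV[R]_k) : (0 <= \prod_(i < k) f (x ord0 i))%R by exact: prodr_ge0.
rewrite ge0_integral_rowS//; last by move=> x; rewrite lee_fin.
transitivity (\int[mu]_t ((f t)%:E * (c ^+ n)%:E)).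
  apply: eq_integral => t _; rewrite -ih.
  rewrite -ge0_integralZl//; [|exact: mp|by move=> x _; rewrite lee_fin|by rewrite lee_fin].
  apply: eq_integral => x _; rewrite -EFinM; congr EFin.
  rewrite big_ord_recl row_cons_head; congr (_ * _)%R.
  by apply: eq_bigr => i _; rewrite row_cons_tail.
rewrite ge0_integralZr//; [|exact/measurable_EFinP|by move=> x _; rewrite lee_fin|].
  by rewrite fc -EFinM exprS.
rewrite lee_fin exprn_ge0// -lee_fin -fc.
by apply: integral_ge0 => x _; rewrite lee_fin.
Qed.

Lemma lebesgue_row_box n (k : R) : (0 <= k)%R ->
  lam n [set x : 'rV[R]_n | (`|x| <= k)%R] = ((2 * k) ^+ n)%:E.
Proof.
move=> k0; have mB := @measurable_norm_le R n k.
have mI : measurable_fun setT (\1_`[(- k)%R, k]%classic : R -> R) by exact: measurable_indic.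
rewrite -(@ge0_integral_row_prod n (\1_`[(- k)%R, k]%classic))//.
  have := integral_indic (lam n) measurableT mB; rewrite setIT => <-.
  apply: eq_integral => x _; congr EFin.
  rewrite indicE; case: (boolP (x \in _)) => [|].
    rewrite inE/= norm_leP// => /forallP h; rewrite big1// => i _.
    by rewrite indicE mem_set//= in_itv/= -ler_norml.
  rewrite notin_setE/= norm_leP// => /negP; rewrite negb_forall => /existsP[i h].
  apply/esym/eqP; rewrite prodf_seq_eq0; apply/hasP; exists i => //=.
    exact: mem_index_enum.
  by rewrite indicE memNset//= in_itv/= -ler_norml; exact/negP.
have -> : \int[mu]_x (\1_`[(- k)%R, k] x)%:E = lebesgue_measure `[(- k)%R, k]%classic.
  by rewrite integral_indic// setIT.
rewrite lebesgue_measure_itv/= lte_fin.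
case: ifPn => [_|]; first by rewrite -EFinB; congr EFin; ring.
rewrite -leNgt => h; have -> : k = 0%R by apply/eqP; rewrite eq_le k0 andbT; lra.
by rewrite mulr0.
Qed.

End lebesgue_row_theory.

Section linear_change.
Context {R : realType} {n : nat}.
Local Notation lam := (@lebesgue_row R n).

Lemma mulmx_bounded (A : 'M[R]_n) :
  exists2 k : R, 0 < k & forall x : 'rV[R]_n, `|x *m A| <= k * `|x|.
Proof.
have [e e0 eP] := entries_bounded A.
exists (n%:R * e + 1) => [|x]; first by rewrite ltr_wpDl// mulr_ge0.
apply: le_trans (@mulmx_le_norm _ _ x A e e0 eP) _.
by rewrite ler_wpM2r// lerDl.
Qed.

Lemma measurable_mulmx (A : 'M[R]_n) :
  measurable_fun setT (fun x : 'rV[R]_n => x *m A).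
Proof. exact: measurable_rowM. Qed.

Local Open Scope ereal_scope.

(** Uniqueness of translation-invariant measures, in the form of Fubini's
argument: the double integral of [g y * f (x A + y)] is computed in both
orders, shifting the inner variable each time. *)
Lemma haar_unique (A : 'M[R]_n) (f g : 'rV[R]_n -> \bar R) : A \in unitmx ->
  measurable_fun setT f -> measurable_fun setT g ->
  (forall x, 0 <= f x) -> (forall x, 0 <= g x) ->
  (\int[lam]_y g y) * (\int[lam]_x f (x *m A)) =
  (\int[lam]_y f y) * (\int[lam]_x g (- (x *m A))%R).
Proof.
move=> uA mf mg f0 g0.
have mfA : measurable_fun setT (fun x : 'rV[R]_n => f (x *m A)).
  exact: measurableT_comp mf (measurable_mulmx A).
have mN : measurable_fun setT (fun x : 'rV[R]_n => (- (x *m A))%R).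
  exact: measurable_rowN (measurable_mulmx A).
have mgA : measurable_fun setT (fun x : 'rV[R]_n => g (- (x *m A))%R).
  exact: measurableT_comp mg mN.
have mfst : measurable_fun setT (fun p : 'rV[R]_n * 'rV[R]_n => p.1) by exact: measurable_fst.
have msnd : measurable_fun setT (fun p : 'rV[R]_n * 'rV[R]_n => p.2) by exact: measurable_snd.
transitivity (\int[lam]_y \int[lam]_x (g y * f (x *m A + y)%R)).
  rewrite -ge0_integralZr//; last by exact: integral_ge0.
  apply: eq_integral => y _.
  rewrite ge0_integralZl//; last first.
    apply: measurableT_comp mf _.
    exact: measurable_rowD (measurable_mulmx A) _.
  congr (_ * _).
  rewrite -(ge0_integral_translation (y *m invmx A) mfA)//.
  by apply: eq_integral => x _; rewrite mulmxDl mulmxKV.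
rewrite -(@fubini_tonelli _ _ _ _ _ lam lam
    (fun p => g p.2 * f (p.1 *m A + p.2)%R))//; last 2 first.
- apply: emeasurable_funM; first exact: measurableT_comp mg msnd.
  apply: measurableT_comp mf _; apply: measurable_rowD => //.
  exact: measurable_rowM.
- by move=> p /=; rewrite mule_ge0.
transitivity (\int[lam]_x \int[lam]_y (g (y - x *m A)%R * f y)).
  apply: eq_integral => x _ /=.
  rewrite -[RHS](ge0_integral_translation (x *m A))//; first last.
  - by move=> y; rewrite mule_ge0.
  - apply: emeasurable_funM => //; apply: measurableT_comp mg _.
    exact: measurable_rowB.
  - by apply: eq_integral => y _; rewrite addrK addrC.
rewrite (@fubini_tonelli _ _ _ _ _ lam lam
    (fun p => g (p.2 - p.1 *m A)%R * f p.2))//; last 2 first.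
- apply: emeasurable_funM; last exact: measurableT_comp mf msnd.
  apply: measurableT_comp mg _; apply: measurable_rowB => //.
  exact: measurable_rowM.
- by move=> p /=; rewrite mule_ge0.
rewrite -ge0_integralZr//; last by exact: integral_ge0.
apply: eq_integral => y _ /=.
have mgyA : measurable_fun setT (fun x : 'rV[R]_n => g (y - x *m A)%R).
  apply: measurableT_comp mg _.
  exact: measurable_rowB _ (measurable_mulmx A).
rewrite ge0_integralZr// muleC; congr (_ * _).
rewrite -(ge0_integral_translation (y *m invmx A) mgyA)//.
by apply: eq_integral => x _; rewrite mulmxDl mulmxKV// opprD addrCA subrr addr0.
Qed.

(** The Jacobian appears as an unspecified positive constant, because it will cancel
in a ratio of integrals. It comes from [haar_unique] with [g] the indicator of
the unit box; it is finite and positive because the preimage of that box lies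
between two boxes. *)
Lemma ge0_integral_linear (A : 'M[R]_n) : A \in unitmx ->
  exists2 c : R, (0 < c)%R & forall f : 'rV[R]_n -> \bar R,
    measurable_fun setT f -> (forall x, 0 <= f x) ->
    \int[lam]_x f (x *m A) = c%:E * \int[lam]_x f x.
Proof.
move=> uA.
pose B k := [set x : 'rV[R]_n | (`|x| <= k)%R].
have mB k : measurable (B k) := measurable_norm_le k.
have lamB k : (0 <= k)%R -> lam (B k) = ((2 * k) ^+ n)%:E by exact: lebesgue_row_box.
pose g (x : 'rV[R]_n) : \bar R := (\1_(B 1%R) x)%:E.
have mg : measurable_fun setT g by apply/measurable_EFinP; exact: measurable_indic.
have g0 x : 0 <= g x by rewrite lee_fin.
have gB : \int[lam]_x g x = (2 ^+ n)%:E.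
  have := integral_indic lam measurableT (mB 1%R).
  by rewrite setIT => ->; apply: etrans (lamB _ ler01) _; rewrite mulr1.
pose D := [set x : 'rV[R]_n | (`|x *m A| <= 1)%R].
have mD : measurable D.
  by rewrite -[X in measurable X]setTI; exact: (measurable_mulmx A measurableT (mB 1%R)).
have gD : \int[lam]_x g (- (x *m A))%R = lam D.
  have -> : lam D = \int[lam]_x (\1_D x)%:E.
    by have := integral_indic lam measurableT mD; rewrite setIT => ->.
  apply: eq_integral => x _.
  by rewrite /g !indicE /B /D !mem_setE !unfold_in/= normrN.
have [k k0 kP] := mulmx_bounded A.
have [l l0 lP] := mulmx_bounded (invmx A).
have Dfin : lam D < +oo.
  apply: (@le_lt_trans _ _ (lam (B l))); last by rewrite lamB ?ltW// ltry.
  apply: le_measure; rewrite ?inE// => x /= xA.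
  rewrite -[x](mulmxK uA); apply: le_trans (lP _) _.
  by rewrite -[leRHS]mulr1 ler_wpM2l// ltW.
have Dpos : 0 < lam D.
  apply: (@lt_le_trans _ _ (lam (B (k^-1)%R))).
    by rewrite lamB ?invr_ge0 ?ltW// lte_fin exprn_gt0// mulr_gt0// invr_gt0.
  apply: le_measure; rewrite ?inE// => x /= xk.
  by apply: le_trans (kP _) _; rewrite -ler_pdivlMl// mulr1.
have Dreal : lam D = (fine (lam D))%:E by rewrite fineK// ge0_fin_numE// measure_ge0.
have two0 : (0 < 2 ^+ n :> R)%R by rewrite exprn_gt0.
exists (fine (lam D) / 2 ^+ n)%R.
  by rewrite divr_gt0// fine_gt0// Dpos Dfin.
move=> f mf f0; have := haar_unique uA mf mg f0 g0.
rewrite gB gD Dreal /= muleC => h.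
rewrite mulrC EFinM -muleA [X in _ * X]muleC -h muleC -muleA -EFinM.
by rewrite divff ?gt_eqF// mule1.
Qed.

End linear_change.

(** * Exponential and Gaussian integrals *)

Section row_integrals.
Context {R : realType} {n : nat}.
Local Notation mu := (@lebesgue_measure R).
Local Notation lam := (@lebesgue_row R n).

Lemma integral_exp_norm1 (c : R) : 0 < c ->
  exists k, (\int[mu]_x (expR (- c * `|x|))%:E = k%:E)%E.
Proof.
move=> c0.
have mf : measurable_fun setT (fun x : R => expR (- c * `|x|)).
  apply: measurableT_comp => //; apply: measurable_funM => //.
exists (2 * c^-1).
rewrite ge0_symfun_integralT//=.
- rewrite EFinM; congr (_ * _)%E.
  transitivity (\int[mu]_x ((exponential_pdf c x)%:E * c^-1%:E))%E; last first.
    rewrite ge0_integralZr//.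
    + by rewrite integral_exponential_pdf// mul1e.
    + by apply/measurable_EFinP; exact: measurable_exponential_pdf.
    + by move=> x _; rewrite lee_fin exponential_pdf_ge0// ltW.
    + by rewrite lee_fin invr_ge0 ltW.
  rewrite [LHS]integral_mkcond; apply: eq_integral => x _.
  rewrite -EFinM /exponential_pdf !patchE.
  have -> : (x \in `[0%R, +oo[%classic) = (x \in [set t : R | 0 <= t]).
    by rewrite !mem_setE in_itv/= andbT.
  case: ifP => [|_]; last by rewrite mul0r.
  rewrite inE/= => x0; congr EFin.
  by rewrite ger0_norm// mulrAC divff ?gt_eqF// mul1r.
- move=> x; apply: continuous_comp; last exact: continuous_expR.
  by apply: continuousM; [exact: cst_continuous|exact: norm_continuous].
- by move=> x /=; rewrite normrN.
Qed.

(** The sup norm is at least the mean of the absolute values of the coordinates,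
so the function is below a product of one-dimensional exponentials. *)
Lemma integrable_exp_norm (c : R) : 0 < c ->
  lam.-integrable setT (fun x => (expR (- c * `|x|))%:E).
Proof.
move=> c0; pose e := c / n.+1%:R.
have e0 : 0 < e by rewrite divr_gt0.
have [k kE] := integral_exp_norm1 e0.
have mf : measurable_fun setT (fun x : R => expR (- e * `|x|)).
  by apply: measurableT_comp => //; apply: measurable_funM.
have mg : measurable_fun setT (fun x : 'rV[R]_n => (expR (- c * `|x|))%:E).
  apply/measurable_EFinP; apply: measurableT_comp => //.
  apply: measurable_funM => //; apply: continuous_row_measurable.
  exact: norm_continuous.
apply/integrableP; split => //.
apply: (@le_lt_trans _ _ (\int[lam]_x (\prod_(i < n) expR (- e * `|x ord0 i|))%:E)%E).
  apply: ge0_le_integral => //.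
  - exact: measurableT_comp.
  - apply/measurable_EFinP; apply: measurable_prod => i _.
    exact: (measurableT_comp mf (measurable_row_coord i)).
  move=> x _; rewrite lee_fin ger0_norm ?expR_ge0// -expR_sum ler_expR.
  rewrite -mulr_sumr !mulNr lerN2 /e -mulrA ler_pM2l//.
  rewrite ler_pdivrMl//; apply: (@le_trans _ _ (\sum_(i < n) `|x|)).
    by apply: ler_sum => i _; exact: coord_le_norm.
  by rewrite sumr_const card_ord -[leLHS]mulr_natl ler_wpM2r// ler_nat.
by rewrite (ge0_integral_row_prod _ mf _ kE)// ltry.
Qed.

Lemma integral_std_gauss :
  (\int[lam]_x (expR (- dot x x / 2))%:E = (Num.sqrt (2 * pi) ^+ n)%:E)%E.
Proof.
have mf : measurable_fun setT (fun x : R => expR (- x ^+ 2 / 2)).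
  apply: measurableT_comp => //; apply: measurable_funM => //.
  apply: measurableT_comp => //.
rewrite -(@ge0_integral_row_prod _ n (fun x => expR (- x ^+ 2 / 2)) (Num.sqrt (2 * pi)))//.
  apply: eq_integral => x _; rewrite -expR_sum -mulr_suml sumrN; congr (expR (- _ / _))%:E.
have := @integral_normal_pdf R 0 1.
have pk : @normal_peak R 1 = (Num.sqrt (2 * pi))^-1.
  by rewrite /normal_peak expr1n mul1r mulr_natl.
have s0 : 0 < Num.sqrt (2 * pi) :> R by rewrite sqrtr_gt0 mulr_gt0// pi_gt0.
under eq_integral => x _.
  rewrite /normal_pdf oner_eq0 pk /normal_fun subr0 expr1n EFinM.
  over.
rewrite ge0_integralZl//=.
- move=> h.
  have := congr1 (fun t => (Num.sqrt (2 * pi))%:E * t)%E h.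
  rewrite muleA -EFinM divff ?gt_eqF// mul1e mule1 => <-.
  by apply: eq_integral => x _.
- by apply/measurable_EFinP.
Qed.

End row_integrals.

(** * Integration against a law given by a density *)

Section integral_density.
Local Open Scope ereal_scope.
Context d (T : measurableType d) (R : realType).
Import HBNNSimple.

(** Simple functions increasing to [f] reduce this to the hypothesis on sets. *)
Lemma ge0_integral_density (nu mu : {measure set T -> \bar R}) (D : set T)
    (q : T -> R) (f : T -> \bar R) :
  measurable D -> measurable_fun D q -> (forall x, D x -> (0 <= q x)%R) ->
  (forall A, measurable A -> nu A = \int[mu]_(x in D `&` A) (q x)%:E) ->
  measurable_fun setT f -> (forall x, 0 <= f x) ->
  \int[nu]_x f x = \int[mu]_(x in D) (f x * (q x)%:E).
Proof.
move=> mD mq q0 nuE mf f0.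
pose f_ := nnsfun_approx measurableT mf.
have f_cvg x : EFin \o f_^~ x @ \oo --> f x by exact: cvg_nnsfun_approx.
have f_nd x m n : (m <= n)%N -> (f_ m x)%:E <= (f_ n x)%:E.
  by move=> mn; rewrite lee_fin; exact/lefP/nd_nnsfun_approx.
transitivity (limn (fun n => \int[nu]_x (f_ n x)%:E)).
  rewrite -monotone_convergence//.
  - by apply: eq_integral => x _; apply/esym/cvg_lim => //; exact: f_cvg.
  - by move=> n; exact/measurable_EFinP/measurable_funP.
  - by move=> n x _; rewrite lee_fin.
  - by move=> x _ m n mn; exact: f_nd.
transitivity (limn (fun n => \int[mu]_(x in D) ((f_ n x)%:E * (q x)%:E))); last first.
  rewrite -monotone_convergence//.
  - apply: eq_integral => x; rewrite inE => Dx; apply/cvg_lim => //.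
    by apply: cvgeZr => //; exact: f_cvg.
  - move=> n; apply: emeasurable_funM => //; last exact/measurable_EFinP.
    exact/measurable_EFinP/measurable_funTS/measurable_funP.
  - by move=> n x Dx; rewrite mule_ge0// lee_fin ?q0.
  - by move=> x Dx m n mn; rewrite lee_wpmul2r ?lee_fin ?q0//; exact: f_nd.
congr (limn _); apply/funext => n.
rewrite integralT_nnsfun sintegralE.
have mfn r : measurable (f_ n @^-1` [set r]) by [].
transitivity (\int[mu]_(x in D) (\sum_(k \in range (f_ n))
    (k * \1_(f_ n @^-1` [set k]) x)%:E * (q x)%:E)); last first.
  apply: eq_integral => x; rewrite inE => Dx.
  rewrite fimfunE -fsumEFin// ge0_mule_fsuml// => k.
  exact: nnfun_muleindic_ge0.
have mi k : measurable_fun D (fun x => (k * \1_(f_ n @^-1` [set k]) x)%:E).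
  by apply/measurable_EFinP; exact: measurable_funM.
rewrite ge0_integral_fsum//; last 2 first.
- by move=> k; apply: emeasurable_funM => //; exact/measurable_EFinP.
- by move=> k x Dx; apply: mule_ge0; [exact: nnfun_muleindic_ge0|rewrite lee_fin q0].
apply: eq_fsbigr => k _; rewrite nuE//.
have [k0|k0] := ltP k 0%R.
  rewrite preimage_nnfun0// setI0 integral_set0 mule0.
  by rewrite integral0_eq// => x _; rewrite indicE in_set0 mulr0 mul0e.
under [RHS]eq_integral do rewrite EFinM -muleA.
rewrite ge0_integralZl//.
- congr (_ * _); rewrite integral_mkcondr; apply: eq_integral => x _.
  rewrite patchE indicE; case: ifP => _; first by rewrite mul1e.
  by rewrite mul0e.
- apply: emeasurable_funM; last exact/measurable_EFinP.
  by apply/measurable_EFinP; exact: measurable_indic.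
- by move=> x Dx; rewrite mule_ge0 ?lee_fin ?q0.
Qed.

End integral_density.

(** * Directional derivatives and the Taylor formula of order two *)

Section line_derivative_filter.
Context {R : realType} {V : normedModType R}.
Implicit Types (f : V -> R) (x v : V).

Lemma is_deriveP f x v (l : R) : is_derive x v f l <->
  (h^-1 * (f (h *: v + x) - f x)) @[h --> 0^'] --> l.
Proof.
split => [[df <-]|fl]; first exact: df.
have df : derivable f x v by apply/cvg_ex; exists l.
by apply: DeriveDef => //; exact: cvg_lim fl.
Qed.

End line_derivative_filter.

Section line_derivative.
Context {R : realType} {V : normedModType R}.
Implicit Types (f : V -> R) (x v : V).

Lemma is_derive_line f x v (s l : R) : is_derive (x + s *: v) v f l ->
  is_derive s 1 (fun t : R => f (x + t *: v)) l.
Proof.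
move=> /is_deriveP h; apply/is_deriveP.
move: h; apply: cvg_trans; apply: near_eq_cvg; near=> t => /=.
by rewrite -[t *: 1]/(t * 1) mulr1 scalerDl addrCA.
Unshelve. all: by end_near. Qed.

Lemma is_derive_scale f x v (c l : R) : is_derive x v f l ->
  is_derive x (c *: v) f (c * l).
Proof.
move=> h; apply/is_deriveP.
have h1 : is_derive (c * 0) 1 (fun t : R => f (x + t *: v)) l.
  by apply: is_derive_line; rewrite mulr0 scale0r addr0.
have h2 : is_derive (0 : R) (1 : R) (fun t : R => c * t) c.
  apply: (is_derive_eq (is_deriveZ c (is_derive_id (0 : R) (1 : R)))).
  by rewrite -[c *: 1]/(c * 1) mulr1.
have := is_derive1_comp h1 h2 => /is_deriveP; rewrite mulrC.
apply: cvg_trans; apply: near_eq_cvg; near=> t => /=.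
rewrite -[t *: 1]/(t * 1) mulr1 addr0 mulr0 scale0r addr0.
by rewrite scalerA [x + _]addrC (mulrC c).
Unshelve. all: by end_near. Qed.

(** The segment is parametrised by [0, 1], which covers both signs of a step
in a coordinate direction. *)
Lemma MVT_line f x v : (forall s : R, 0 <= s <= 1 -> derivable f (x + s *: v) v) ->
  exists2 s : R, 0 < s < 1 & f (x + v) - f x = 'D_v f (x + s *: v).
Proof.
move=> df; pose g (s : R) := f (x + s *: v).
have dg (s : R) : 0 <= s <= 1 -> is_derive s 1 g ('D_v f (x + s *: v)).
  by move=> s01; apply: is_derive_line; apply: derivableP; exact: df.
have [||s] := @MVT R g (fun s => 'D_v f (x + s *: v)) 0 1 ltr01.
- by move=> s; rewrite in_itv/= => /andP[s0 s1]; apply: dg; rewrite !ltW.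
- by apply: derivable_within_continuous => s; rewrite in_itv/= => /dg[].
rewrite in_itv/= => s01; rewrite /g scale1r scale0r addr0 subr0 mulr1 => e.
by exists s.
Qed.

End line_derivative.

Section directional.
Context {R : realType} {m : nat}.
Implicit Types (f : 'rV[R]_m -> R) (x v : 'rV[R]_m).

(** The increment is split at [x + h v]: the mean value theorem turns the part
along the coordinate axis into a partial derivative at a point tending to [x].
Adding the axes one at a time yields all directional derivatives of a [C^1]
function. *)
Lemma is_derive_add_delta f x v (i : 'I_m) (c l : R) :
  is_derive x v f l ->
  (\forall y \near x, derivable f y (delta_mx ord0 i)) ->
  {for x, continuous (partial i f)} ->
  is_derive x (c *: delta_mx ord0 i + v) f (c * partial i f x + l).
Proof.
move=> /is_deriveP fv df cf; apply/is_deriveP; set e := delta_mx ord0 i.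
have -> : (fun h : R => h^-1 * (f (h *: (c *: e + v) + x) - f x)) =
    (fun h => h^-1 * (f (h *: (c *: e + v) + x) - f (h *: v + x)) +
              h^-1 * (f (h *: v + x) - f x)).
  by apply/funext => h; rewrite -mulrDr addrA subrK.
apply: cvgD => //.
apply/cvgrPdist_lt => eps eps0.
have [e' e'0 ce'] : exists2 e' : R, 0 < e' & `|c| * e' < eps.
  exists (eps / (`|c| + 1)); first by rewrite divr_gt0// ltr_wpDl.
  rewrite mulrCA gtr_pMr// ltr_pdivrMr ?ltr_wpDl// mul1r ltrDl//.
have : \forall y \near x, `|partial i f x - partial i f y| < e' /\ derivable f y e.
  apply: filterI => //; move/cvgrPdist_lt : cf; exact.
move=> /nbhs_ballP[r /= r0 rP].
pose k := `|c *: e| + `|v| + 1.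
have k0 : 0 < k by rewrite ltr_wpDl// addr_ge0.
near=> h.
have h0 : h != 0 by near: h; exact: nbhs_dnbhs_neq.
have hr : `|h| < r / k.
  near: h; apply: dnbhs0_lt; exact: divr_gt0.
have inball s : 0 <= s <= 1 -> ball x r (h *: v + x + s *: ((h * c) *: e)).
  move=> /andP[s0 s1]; rewrite -ball_normE /=.
  rewrite (_ : x - _ = - (h *: (v + s *: (c *: e)))); last first.
    by apply/rowP => j; rewrite !mxE; ring.
  rewrite normrN normrZ; apply: (@le_lt_trans _ _ (`|h| * k)); last first.
    by rewrite -ltr_pdivlMr.
  rewrite ler_wpM2l// (le_trans (ler_normD _ _))//.
  rewrite /k [`|c *: e| + _]addrC -addrA lerD2l normrZ ger0_norm//.
  by rewrite (le_trans (ler_wpM2r _ s1))// mul1r lerDl.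
have [s s01|s s01 E] := @MVT_line _ _ f (h *: v + x) ((h * c) *: e).
  have [_ df'] := rP _ (inball s s01).
  by have [] := is_derive_scale (h * c) (derivableP df').
have {}s01 : 0 <= s <= 1 by move: s01 => /andP[? ?]; rewrite !ltW.
have [dist df'] := rP _ (inball s s01).
have E2 := @derive_val _ _ _ _ _ _ _ (is_derive_scale (h * c) (derivableP df')).
rewrite (_ : h *: (c *: e + v) + x = h *: v + x + (h * c) *: e); last first.
  by apply/rowP => j; rewrite !mxE; ring.
rewrite E E2 mulrA mulrA mulVf// mul1r -/(partial i f _) -mulrBr normrM.
apply: le_lt_trans ce'.
by rewrite ler_wpM2l// ltW.
Unshelve. all: by end_near. Qed.

Lemma C1_is_derive f (D : set 'rV[R]_m) x v : open D -> Ck 1 D f -> D x ->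
  is_derive x v f (dot v (gradient f x)).
Proof.
move=> oD [_ C1] Dx.
rewrite {1}(row_sum_delta v) /dot; elim/big_rec2: _ => [|i l w _ ih].
  exact: is_derive0.
have [d [c _]] := C1 i.
rewrite mxE; apply: is_derive_add_delta => //; last exact: c.
near=> y; apply: d; near: y; exact: open_nbhs_nbhs.
Unshelve. all: by end_near. Qed.

End directional.

Section taylor.
Context {R : realType} {m : nat}.
Implicit Types (f : 'rV[R]_m -> R) (x v : 'rV[R]_m) (D : set 'rV[R]_m).

Lemma Ck_le f D (k l : nat) : (k <= l)%N -> Ck l D f -> Ck k D f.
Proof.
elim: k l f => [|k ih] [|l] f //; first by move=> _ [].
rewrite ltnS => kl [cf h]; split => // i; have [d c] := h i.
by split => //; exact: ih c.
Qed.

Lemma hessian_quad f x v :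
  dot (v *m hessian f x) v = \sum_i v ord0 i * dot v (gradient (partial i f) x).
Proof.
apply: eq_bigr => i _; rewrite mulrC mxE; congr (_ * _).
by apply: eq_bigr => j _; rewrite !mxE.
Qed.

(** Lagrange's remainder, by Rolle's theorem applied to
[p s + p' s (1 - s) + K (1 - s)^2] with [K] chosen to equalise the end points. *)
Lemma taylor2 f D x v : open D -> Ck 2 D f ->
  (forall s : R, 0 <= s <= 1 -> D (x + s *: v)) ->
  exists2 s : R, 0 < s < 1 & f (x + v) =
    f x + dot v (gradient f x) + dot (v *m hessian f (x + s *: v)) v / 2.
Proof.
move=> oD C2 seg.
pose p (s : R) := f (x + s *: v).
pose p1 (s : R) := dot v (gradient f (x + s *: v)).
pose p2 (s : R) := dot (v *m hessian f (x + s *: v)) v.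
have dp (s : R) : 0 <= s <= 1 -> is_derive s 1 p (p1 s).
  move=> s01; apply: is_derive_line; apply: C1_is_derive oD _ (seg _ s01).
  exact: Ck_le C2.
have dp1 (s : R) : 0 <= s <= 1 -> is_derive s 1 p1 (p2 s).
  move=> s01; rewrite /p2 hessian_quad.
  have -> : p1 = \sum_(i < m) (v ord0 i \*o (fun t => partial i f (x + t *: v))).
    by apply/funext => t; rewrite fct_sumE /p1 /dot; apply: eq_bigr => i _; rewrite mxE.
  apply: is_derive_sum => i.
  apply: is_deriveZ; apply: is_derive_line.
  by apply: C1_is_derive oD _ (seg _ s01); have [_ /(_ i)[]] := C2.
pose K := p 1 - p 0 - p1 0.
pose r (s : R) := p s + p1 s * (1 - s) + K * (1 - s) ^+ 2.
have dr (s : R) : 0 <= s <= 1 -> is_derive s 1 r ((p2 s - 2 * K) * (1 - s)).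
  move=> s01.
  have d1 : is_derive s (1 : R) (fun t : R => 1 - t) (- 1).
    apply: (is_derive_eq (is_deriveB (is_derive_cst (1 : R) s 1) (is_derive_id s 1))).
    by rewrite sub0r.
  have h := is_deriveD (is_deriveD (dp s s01) (is_deriveM (dp1 s s01) d1))
             (is_deriveZ K (is_deriveX 2 d1)).
  have -> : r = p + p1 * (fun t : R => 1 - t) + K *: ((fun t : R => 1 - t) ^+ 2).
    by apply/funext => t; rewrite /r !fctE.
  apply: (is_derive_eq h); rewrite /GRing.scale/= expr1; ring.
have [||||s] := @Rolle R r 0 1.
- exact: ltr01.
- by move=> s; rewrite in_itv/= => /andP[s0 s1]; have [|] := dr s; first by rewrite !ltW.
- by apply: derivable_within_continuous => s; rewrite in_itv/= => /dr[].
- by rewrite /r subrr mulr0 subr0 expr0n/= mulr0 !addr0 expr1n !mulr1 /K; ring.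
rewrite in_itv/= => /andP[s0 s1] [_ e].
exists s; first by rewrite s0.
have [|_] := dr s; first by rewrite !ltW.
rewrite e => /esym/eqP; rewrite mulf_eq0 !subr_eq0 [1 == s]eq_sym (lt_eqF s1) orbF.
move=> /eqP p2s.
rewrite -/(p2 s) p2s mulrC mulKf ?pnatr_eq0// /K /p /p1 scale1r scale0r addr0; ring.
Qed.

Lemma segment_ball x v (c : 'rV[R]_m) (r : R) (s : R) :
  `|x - c| < r -> `|x + v - c| < r -> 0 <= s <= 1 -> `|x + s *: v - c| < r.
Proof.
move=> h0 h1 /andP[s0 s1].
rewrite (_ : x + s *: v - c = (1 - s) *: (x - c) + s *: (x + v - c)); last first.
  by apply/rowP => j; rewrite !mxE; ring.
apply: le_lt_trans (ler_normD _ _) _; rewrite !normrZ ger0_norm ?subr_ge0// (ger0_norm s0).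
have [s00|s00] := eqVneq s 0; first by rewrite s00 subr0 mul1r mul0r addr0.
apply: (@lt_le_trans _ _ ((1 - s) * r + s * r)); last by rewrite -mulrDl subrK mul1r.
rewrite ler_ltD// ?ler_wpM2l ?subr_ge0// ?ltW// ltr_pM2l// lt_neqAle eq_sym s00//.
Qed.

End taylor.

(** * Bregman divergence of the log-partition function *)

(** The domain need not be convex: the inequality is required only at those points
of a segment that lie in [D] together with its end points. *)
Definition segment_convex (R : realType) m (D : set 'rV[R]_m) (f : 'rV[R]_m -> R) :=
  forall a b s, 0 <= s <= 1 -> D a -> D b -> D (a + s *: (b - a)) ->
  f (a + s *: (b - a)) <= (1 - s) * f a + s * f b.

Lemma half_dist (R : realFieldType) (q qy qa e : R) :
  `|qy - q| <= e -> `|qa - q| <= e -> `|qy / 2 - qa / 2| <= e.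
Proof. by rewrite !ler_distl => /andP[? ?] /andP[? ?]; apply/andP; split; lra. Qed.

Lemma dist_le_eq (R : realFieldType) (a a' b b' : R) : a' = a -> b' = b ->
  forall e, `|b - a| <= e -> `|a' - b'| <= e.
Proof. by move=> -> -> e; rewrite distrC. Qed.

Lemma hessianE (R : realType) m (f : 'rV[R]_m -> R) x i j :
  hessian f x i j = partial i (partial j f) x.
Proof. by rewrite mxE. Qed.

Lemma subr_mxE (R : zmodType) m n (A B : 'M[R]_(m, n)) i j :
  (A - B) i j = A i j - B i j.
Proof. by rewrite !mxE. Qed.

Section curvature.
Context {R : realType} {m : nat}.
Variables (D : set 'rV[R]_m) (f : 'rV[R]_m -> R) (x0 : 'rV[R]_m).
Hypotheses (oD : open D) (C2 : Ck 2 D f) (Dx0 : D x0).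
Hypothesis pH : posdefmx (hessian f x0).
Hypothesis convf : segment_convex D f.

(** The Bregman divergence of [f]. *)
Definition breg a b := f b - f a - dot (b - a) (gradient f a).

Lemma hessian_close (eps : R) : 0 < eps -> exists2 r : R, 0 < r &
  forall y, `|y - x0| < r -> D y /\ forall v,
  `|dot (v *m hessian f y) v - dot (v *m hessian f x0) v| <= eps * `|v| ^+ 2.
Proof.
move=> eps0.
have [e e0 he] : exists2 e : R, 0 < e & m%:R ^+ 2 * e <= eps.
  exists (eps / (m%:R ^+ 2 + 1)).
    by rewrite divr_gt0// ltr_wpDl// exprn_ge0.
  rewrite mulrCA ger_pMr// ler_pdivrMr ?ltr_wpDl ?exprn_ge0//.
  by rewrite mul1r lerDl.
have : \forall y \near x0, forall ij : 'I_m * 'I_m,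
    `|hessian f y ij.1 ij.2 - hessian f x0 ij.1 ij.2| <= e.
  apply: (@filter_forall _ _ (fun ij : 'I_m * 'I_m => [set y |
    `|hessian f y ij.1 ij.2 - hessian f x0 ij.1 ij.2| <= e]) _ (nbhs_filter x0)) => -[i j] /=.
  have [_ /(_ j)[_ [_ /(_ i)[_ [/(_ _ Dx0) c _]]]]] := C2.
  have c' : \forall y \near x0,
      `|partial i (partial j f) x0 - partial i (partial j f) y| <= e.
    by move/cvgrPdist_le : c; exact.
  have imp y := dist_le_eq (hessianE f y i j) (hessianE f x0 i j).
  exact: filterS (fun y h => imp y e h) c'.
move=> hclose.
have : \forall y \near x0, D y by exact: open_nbhs_nbhs.
move=> /(filterI hclose)/nbhs_ballP[r /= r0 rP].
exists r => // y yr; have [|h1 h2] := rP y.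
  by rewrite -ball_normE /= distrC.
split => // v; rewrite -dotBl -mulmxBr.
apply: le_trans (@quad_le_norm _ _ v _ e (ltW e0) _) _.
  by move=> i j; rewrite subr_mxE; exact: h1 (i, j).
by rewrite ler_wpM2r// sqr_ge0.
Qed.

Lemma breg_hessian a b (r : R) : (forall y, `|y - x0| < r -> D y) ->
  `|a - x0| < r -> `|b - x0| < r ->
  exists2 y, `|y - x0| < r & breg a b = dot ((b - a) *m hessian f y) (b - a) / 2.
Proof.
move=> ballD ar br.
have br' : `|a + (b - a) - x0| < r by rewrite subrKC.
have [|s s01 E] := @taylor2 _ _ f D a (b - a) oD C2.
  by move=> s s01; apply: ballD; exact: segment_ball.
exists (a + s *: (b - a)).
  by apply: segment_ball => //; move: s01 => /andP[? ?]; rewrite !ltW.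
by move: E; rewrite /breg subrKC => ->; ring.
Qed.

Lemma quad_bounds : exists k L r : R, [/\ 0 < k, 0 < L, 0 < r &
  forall y, `|y - x0| < r -> D y /\ forall v,
    k * `|v| ^+ 2 <= dot (v *m hessian f y) v <= L * `|v| ^+ 2].
Proof.
have [k k0 kP] := posdefmx_coercive pH.
have k20 : 0 < k / 2 by rewrite divr_gt0.
have [r r0 rP] := hessian_close k20.
have [e e0 eP] := entries_bounded (hessian f x0).
exists (k / 2), (m%:R ^+ 2 * e + k / 2), r; split => //.
  by rewrite ltr_wpDl// mulr_ge0// exprn_ge0.
move=> y /rP[Dy close]; split => // v; move: (close v); rewrite ler_distl => /andP[h1 h2].
apply/andP; split.
  apply: le_trans h1; rewrite lerBrDr -mulrDl -splitr.
  by apply: le_trans (kP v); rewrite ler_wpM2l ?(ltW k0)// norm_le_dot.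
apply: le_trans h2 _; rewrite mulrDl lerD2r.
by apply: le_trans (ler_norm _) _; exact: quad_le_norm.
Qed.

Lemma breg_le (a b : 'rV[R]_m) (s : R) : D a -> D b -> 0 <= s <= 1 ->
  D (a + s *: (b - a)) -> breg a (a + s *: (b - a)) <= s * breg a b.
Proof.
move=> Da Db s01 Dab; have := convf s01 Da Db Dab.
rewrite /breg [a + _ - a]addrC addKr dotZl => h; rewrite mulrBr lerD2r.
by rewrite lerBlDr (le_trans h)// le_eqVlt; apply/orP; left; apply/eqP; ring.
Qed.

(** Taylor's formula bounds the divergence near [x0] by quadratic functions.
Farther away convexity along the segment from [a] forces at least linear
growth: the divergence at the point of the segment at distance [rho] from [a]
is at most the corresponding fraction of the divergence at the end point. *)
Lemma breg_growth : exists k L rho : R, [/\ 0 < k, 0 < L, 0 < rho &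
  forall a, `|a - x0| < rho -> [/\ D a,
    (forall v, k * `|v| ^+ 2 <= dot (v *m hessian f a) v <= L * `|v| ^+ 2),
    (forall b, D b -> k * (Num.min `|b - a| rho * `|b - a|) <= breg a b) &
    (forall z, `|z| < rho -> D (a + z) /\ breg a (a + z) <= L * `|z| ^+ 2)]].
Proof.
have [k [L [r [k0 L0 r0 rP]]]] := quad_bounds.
have k20 : 0 < k / 2 by rewrite divr_gt0.
have rho0 : 0 < r / 3 by rewrite divr_gt0.
have rhor : r / 3 < r by rewrite ltr_pdivrMr// ltr_pMr// ltr1n.
have ballD y : `|y - x0| < r -> D y by move=> /rP[].
have near3 a z : `|a - x0| < r / 3 -> `|z| <= r / 3 -> `|a + z - x0| < r.
  move=> h1 h2; rewrite addrAC; apply: le_lt_trans (ler_normD _ _) _.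
  by rewrite (_ : r = r / 3 + r / 3 + r / 3); [lra|field].
have loc a z : `|a - x0| < r / 3 -> `|z| <= r / 3 ->
    k / 2 * `|z| ^+ 2 <= breg a (a + z) <= L * `|z| ^+ 2.
  move=> ar zr.
  have [y yr ->] := breg_hessian ballD (lt_trans ar rhor) (near3 _ _ ar zr).
  rewrite [a + z - a]addrC addKr.
  have [_ /(_ z)/andP[h1 h2]] := rP _ yr.
  have zz : 0 <= `|z| ^+ 2 by rewrite sqr_ge0.
  have Lz : 0 <= L * `|z| ^+ 2 by rewrite mulr_ge0// ltW.
  by apply/andP; split; lra.
exists (k / 2), L, (r / 3); split => // a ar.
have [Da qa] := rP _ (lt_trans ar rhor).
split => //.
- move=> v; have /andP[h1 h2] := qa v; rewrite h2 andbT (le_trans _ h1)//.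
  by rewrite ler_wpM2r ?sqr_ge0//; lra.
- move=> b Db; have [z_le|z_gt] := leP `|b - a| (r / 3).
    have := loc a (b - a) ar z_le; rewrite subrKC.
    by rewrite expr2 => /andP[].
  have z0 : 0 < `|b - a| by exact: lt_trans z_gt.
  pose s := r / 3 / `|b - a|.
  have s0 : 0 < s by rewrite divr_gt0.
  have s01 : 0 <= s <= 1 by rewrite ltW//= ler_pdivrMr// mul1r ltW.
  have ns : `|s *: (b - a)| = r / 3.
    by rewrite normrZ gtr0_norm// /s divfK// gt_eqF.
  have := loc a (s *: (b - a)) ar; rewrite ns lexx => /(_ isT) /andP[h1 _].
  have Ds : D (a + s *: (b - a)) by apply/ballD/near3 => //; rewrite ns.
  have h2 := le_trans h1 (breg_le Da Db s01 Ds).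
  rewrite -(ler_pM2l s0) (le_trans _ h2)// le_eqVlt; apply/orP; left; apply/eqP.
  by rewrite /s; field; rewrite gt_eqF.
- move=> z zr; have zr' := ltW zr; split; first exact/ballD/near3.
  by have /andP[] := loc a z ar zr'.
Qed.

(** The quadratic approximation is uniform in the base point [a], because the
Hessian is continuous at [x0]. *)
Lemma breg_quad (eps : R) : 0 < eps -> exists2 r : R, 0 < r &
  forall a z, `|a - x0| < r -> `|z| < r ->
  `|breg a (a + z) - dot (z *m hessian f a) z / 2| <= eps * `|z| ^+ 2.
Proof.
move=> eps0; have [r r0 rP] := hessian_close eps0.
have rho0 : 0 < r / 2 by rewrite divr_gt0.
have rhor : r / 2 < r by rewrite ltr_pdivrMr// ltr_pMr// ltr1n.
exists (r / 2) => // a z ar zr.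
have ballD y : `|y - x0| < r -> D y by move=> /rP[].
have azr : `|a + z - x0| < r.
  by rewrite addrAC; apply: le_lt_trans (ler_normD _ _) _; lra.
have [y yr ->] := breg_hessian ballD (lt_trans ar rhor) azr.
rewrite [a + z - a]addrC addKr.
have [_ /(_ z) h1] := rP _ yr.
have [_ /(_ z) h2] := rP _ (lt_trans ar rhor).
exact: half_dist h1 h2.
Qed.

End curvature.

(** * Mean and mode of the conjugate density *)

Section posterior.
Context {R : realType} {m : nat}.
Variables (D : set 'rV[R]_m) (f : 'rV[R]_m -> R) (x0 : 'rV[R]_m).
Hypotheses (oD : open D) (C2 : Ck 2 D f) (Dx0 : D x0).
Hypothesis pH : posdefmx (hessian f x0).
Hypothesis convf : segment_convex D f.
Local Notation lam := (@lebesgue_row R m).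
Local Notation breg := (breg f).

(** The unnormalised conjugate density. *)
Definition gibbs (alpha : R) (beta x : 'rV[R]_m) : R := expR (dot x beta - alpha * f x).

(** Around any base point [t] the density is a Gaussian-like bump given by the
divergence, tilted by the linear form [v := grad f t - beta / alpha]. *)
Lemma gibbs_breg alpha beta t x : alpha != 0 -> gibbs alpha beta x =
  gibbs alpha beta t *
  expR (- (alpha * (breg t x + dot (x - t) (gradient f t - alpha^-1 *: beta)))).
Proof.
move=> a0; rewrite /gibbs -expRD /breg dotBr dotZr !dotBl.
congr expR.
move: (dot x _) (dot t _) (dot x _) (dot t _) (f x) (f t) => p1 p2 p3 p4 p5 p6.
by field.
Qed.

Lemma x_expN_le1 (x : R) : x * expR (- x) <= 1.
Proof.
rewrite expRN ler_pdivrMr ?expR_gt0// mul1r (le_trans _ (expR_ge1Dx x))//.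
by rewrite lerDr.
Qed.

Lemma min_mul_ge (u rho : R) : 0 <= u -> 0 <= rho ->
  rho * u - rho ^+ 2 <= Num.min u rho * u.
Proof.
move=> u0 r0; have [h|h] := leP u rho.
  by have := sqr_ge0 (u - rho); nra.
by rewrite lerBlDr lerDl sqr_ge0.
Qed.

Lemma centered_integral (w : 'rV[R]_m -> R) (t v : 'rV[R]_m) :
  lam.-integrable D (fun x => (w x)%:E) ->
  (forall j, lam.-integrable D (fun x => (x ord0 j * w x)%:E)) ->
  (forall j, \int[lam]_(x in D) (x ord0 j * w x) =
             t ord0 j * \int[lam]_(x in D) w x) ->
  lam.-integrable D (fun x => (dot (x - t) v * w x)%:E) /\
  (\int[lam]_(x in D) (dot (x - t) v * w x)%:E = 0)%E.
Proof.
move=> iw ixw mw; have mD := measurable_row_open oD.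
have E x : dot (x - t) v * w x =
    \sum_(j < m) v ord0 j * (x ord0 j * w x - t ord0 j * w x).
  rewrite /dot mulr_suml; apply: eq_bigr => j _; rewrite !mxE; ring.
have itw j : lam.-integrable D (fun x => (t ord0 j * w x)%:E).
  by under eq_fun do rewrite EFinM; exact: integrableZl.
have id j : lam.-integrable D (fun x => (x ord0 j * w x - t ord0 j * w x)%:E).
  by under eq_fun do rewrite EFinB; exact: integrableB.
have ivd j : lam.-integrable D (fun x => (v ord0 j * (x ord0 j * w x - t ord0 j * w x))%:E).
  by under eq_fun do rewrite EFinM; exact: integrableZl.
have EF : (fun x => (dot (x - t) v * w x)%:E) = (fun x =>
    \sum_(j < m) (v ord0 j * (x ord0 j * w x - t ord0 j * w x))%:E)%E.
  by apply/funext => x; rewrite E sumEFin.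
rewrite EF; split; first exact: integrable_sum.
rewrite integral_sum//; apply: big1 => j _.
under eq_integral do rewrite EFinM.
rewrite integralZl//.
under eq_integral do rewrite EFinB.
rewrite integralB_EFin//; [|exact: ixw|exact: itw].
rewrite -(fineK (integrable_fin_num mD (ixw j))) -(fineK (integrable_fin_num mD (itw j))).
have := mw j; rewrite -RintegralZl// /Rintegral => ->.
by rewrite subee// mule0.
Qed.

(** If the tilt [v] at the mean [t] had norm at least [eps], the mass would sit on
the side of [t] where [v] is negative, against [t] being the mean. Where the
linear form [u] is positive, [u exp(- alpha u) <= 1 / alpha] bounds the first
moment by [C / alpha]; on a box of fixed size centred at [t - kap v / |v|] the
linear form beats the quadratic divergence, so the integrand is at most a
fixed negative constant. For large [alpha] the two cannot balance. *)
Lemma mean_gradient : exists2 rho : R, 0 < rho &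
  forall eps : R, 0 < eps -> exists A : R, forall alpha beta t, A < alpha ->
  `|t - x0| < rho ->
  lam.-integrable D (fun x => (gibbs alpha beta x)%:E) ->
  (forall j, lam.-integrable D (fun x => (x ord0 j * gibbs alpha beta x)%:E)) ->
  (forall j, \int[lam]_(x in D) (x ord0 j * gibbs alpha beta x) =
             t ord0 j * \int[lam]_(x in D) gibbs alpha beta x) ->
  `|gradient f t - alpha^-1 *: beta| < eps.
Proof.
have [k [L [rho [k0 L0 rho0 H]]]] := breg_growth oD C2 Dx0 pH convf.
exists rho => // eps eps0.
have mD := measurable_row_open oD.
pose g (z : 'rV[R]_m) := expR (k * rho ^+ 2) * expR (- (k * rho) * `|z|).
have ig : lam.-integrable setT (fun z => (g z)%:E).
  rewrite /g; under eq_fun do rewrite EFinM.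
  by apply: integrableZl => //; apply: integrable_exp_norm; exact: mulr_gt0.
have [C Cg] : exists C : R, (\int[lam]_z (g z)%:E = C%:E)%E.
  have /integrable_fin_num := ig => /(_ measurableT) /fineK <-.
  by eexists.
(* small enough for the box to lie in the region of quadratic control and for
   the linear form to outweigh the divergence on it *)
pose kap := Num.min (rho / 4) (eps / (8 * L)).
have kap0 : 0 < kap by rewrite lt_min !divr_gt0// mulr_gt0.
have kap1 : kap <= rho / 4 by rewrite ge_min lexx.
have kap2 : kap <= eps / (8 * L) by rewrite ge_min lexx orbT.
pose del := kap / (2 * m.+1%:R).
have del0 : 0 < del by rewrite divr_gt0// mulr_gt0.
pose c := kap * eps / 2.
have c0 : 0 < c by rewrite divr_gt0// mulr_gt0.
pose vol := (2 * del) ^+ m.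
have vol0 : 0 < vol by rewrite exprn_gt0// mulr_gt0.
exists (Num.max 1 (C / (c * vol))) => alpha beta t.
rewrite gt_max => /andP[alpha1 alphaC] tx iK ixK mK.
have alpha0 : 0 < alpha by exact: lt_trans alpha1.
set v := gradient f t - _.
rewrite ltNge; apply/negP => veps.
have v0 : 0 < `|v| by exact: lt_le_trans veps.
have [Dt _ growth upper] := H _ tx.
have Kt0 : 0 < gibbs alpha beta t by exact: expR_gt0.
pose F x := (gibbs alpha beta t)^-1 * (dot (x - t) v * gibbs alpha beta x).
have FE x : F x = dot (x - t) v * expR (- (alpha * (breg t x + dot (x - t) v))).
  rewrite /F (gibbs_breg beta t x (lt0r_neq0 alpha0)) -/v mulrCA; congr (_ * _).
  by rewrite mulKf// gt_eqF.
have [iG G0] := centered_integral v iK ixK mK.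
have iF : lam.-integrable D (fun x => (F x)%:E).
  by rewrite /F; under eq_fun do rewrite EFinM; exact: integrableZl.
have F0 : (\int[lam]_(x in D) (F x)%:E = 0)%E.
  rewrite /F; under eq_integral do rewrite EFinM.
  by rewrite integralZl// G0 mule0.
have mtr a : measurable_fun setT (fun x : 'rV[R]_m => x - a).
  by apply: measurable_rowB; [exact: measurable_id|exact: measurable_cst].
have mg : measurable_fun setT (fun x => (g x)%:E) by exact: measurable_int ig.
have g0 x : 0 <= g x by rewrite mulr_ge0// expR_ge0.
pose z0 := - (kap / `|v|) *: v.
have nz0 : `|z0| = kap.
  by rewrite normrZ normrN gtr0_norm ?divr_gt0// divfK// gt_eqF.
pose B := [set x : 'rV[R]_m | `|x - (t + z0)| <= del].
have del_kap : del <= kap.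
  by rewrite ler_pdivrMr ?mulr_gt0// ler_peMr ?(ltW kap0)// -natrM ler1n.
have inB x : B x -> `|x - t| <= 2 * kap /\ dot (x - t) v <= - c.
  move=> Bx; set z := x - t.
  have zz0 : `|z - z0| <= del by move: Bx; rewrite /B/= /z opprD addrA.
  split.
    rewrite -[z](subrK z0); apply: le_trans (ler_normD _ _) _.
    by rewrite nz0 mulr_natl mulr2n lerD2r (le_trans zz0).
  rewrite -[z](subrK z0) dotDl.
  have h1 : dot z0 v <= - (kap * `|v|).
    rewrite /z0 dotZl mulNr lerN2 -mulrA ler_pM2l// ler_pdivlMl//.
    by rewrite -expr2 norm_le_dot.
  have h2 : dot (z - z0) v <= kap * `|v| / 2.
    apply: le_trans (ler_norm _) _; apply: le_trans (dot_le_norm _ _) _.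
    rewrite [leRHS]mulrAC ler_pM2r//; apply: le_trans (ler_wpM2l (ler0n _ _) zz0) _.
    rewrite /del [leLHS](_ : _ = kap / 2 * (m%:R / m.+1%:R)).
      by rewrite ger_pMr ?divr_gt0// ler_pdivrMr// mul1r ler_nat.
    by field; apply: lt0r_neq0; have := ler0n R m; lra.
  have h3 : kap * eps <= kap * `|v| by rewrite ler_pM2l.
  by rewrite /c; move: h1 h2 h3; move: (dot z0 v) (dot _ v) => p q; lra.
have mB : measurable B.
  rewrite -[X in measurable X]setTI.
  exact: (mtr (t + z0) measurableT _ (measurable_norm_le del)).
have BD : B `<=` D.
  move=> x /inB[xt _]; have [|Dx _] := upper (x - t).
    by apply: le_lt_trans xt _; move: rho0 kap1; lra.
  by move: Dx; rewrite subrKC.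
have FB x : B x -> F x <= - c.
  move=> Bx; have [xt xv] := inB x Bx.
  have [|_ bx] := upper (x - t).
    by apply: le_lt_trans xt _; move: rho0 kap1; lra.
  rewrite subrKC in bx.
  have bc : breg t x <= c.
    apply: le_trans bx _; apply: (@le_trans _ _ (L * (2 * kap) ^+ 2)).
      by rewrite ler_pM2l// lerXn2r ?nnegrE// mulr_ge0// ltW.
    rewrite /c (_ : L * _ = kap * (kap * (8 * L)) / 2); last by field.
    by rewrite ler_pM2r// ler_pM2l// -ler_pdivlMr// mulr_gt0.
  rewrite FE (le_trans _ xv)//.
  have e1 : 1 <= expR (- (alpha * (breg t x + dot (x - t) v))).
    rewrite -[leLHS]expR0 ler_expR oppr_ge0 pmulr_rle0//.
    by move: bc xv; move: (breg t x) (dot _ v) => p q; lra.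
  rewrite -[leRHS]mulr1 ler_wnM2l//.
  by apply: le_trans xv _; rewrite oppr_le0 ltW.
have Fg x : D x -> F x <= alpha^-1 * g (x - t).
  move=> Dx; rewrite FE; set u := dot (x - t) v.
  have gp : 0 <= alpha^-1 * g (x - t).
    by rewrite mulr_ge0 ?invr_ge0 ?(ltW alpha0)// mulr_ge0// expR_ge0.
  have [u0|u0] := leP u 0.
    by apply: le_trans gp; rewrite mulr_le0_ge0// expR_ge0.
  have h1 : u * expR (- (alpha * u)) <= alpha^-1.
    by rewrite -[leRHS]mulr1 ler_pdivlMl// mulrA x_expN_le1.
  have h2 : expR (- (alpha * breg t x)) <= g (x - t).
    rewrite /g -expRD ler_expR.
    have := min_mul_ge (normr_ge0 (x - t)) (ltW rho0).
    have := growth _ Dx.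
    have : 0 <= Num.min `|x - t| rho * `|x - t|.
      by rewrite mulr_ge0// le_min normr_ge0 ltW.
    move: (breg t x) (Num.min `|x - t| rho * `|x - t|) `|x - t| => b q y q0 qb qy.
    have b0 : 0 <= b by apply: le_trans qb; rewrite mulr_ge0// ltW.
    have ab : b <= alpha * b by rewrite ler_peMl// ltW.
    have kq := ler_wpM2l (ltW k0) qy.
    by lra.
  rewrite mulrDr opprD expRD mulrCA mulrC ler_pM ?expR_ge0//.
  by rewrite mulr_ge0 ?expR_ge0// ltW.
have lamB : (\int[lam]_(x in D) (\1_B x)%:E = vol%:E)%E.
  rewrite integral_indic// (setIidl BD) -[B]setIT -integral_indic//.
  pose B0 := [set x : 'rV[R]_m | `|x| <= del].
  have mB0 : measurable B0 := measurable_norm_le del.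
  transitivity (\int[lam]_x (\1_B0 (x + - (t + z0)))%:E)%E.
    by apply: eq_integral => x _; rewrite !indicE !mem_setE.
  rewrite (ge0_integral_translation _ (f := fun x => (\1_B0 x)%:E))//.
    by rewrite integral_indic// setIT; exact: lebesgue_row_box (ltW del0).
  by apply/measurable_EFinP; exact: measurable_indic.
have mgt : measurable_fun setT (fun x : 'rV[R]_m => (g (x - t))%:E).
  exact: measurableT_comp mg (mtr t).
have gint : (\int[lam]_(x in D) (g (x - t))%:E <= C%:E)%E.
  rewrite -Cg -(ge0_integral_translation (- t) mg)//.
  by apply: ge0_subset_integral => // x _; rewrite lee_fin.
have igD : lam.-integrable D (fun x => (g (x - t))%:E).
  apply/integrableP; split; first exact: measurable_funTS.
  under eq_integral do rewrite /= ger0_norm//.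
  by apply: le_lt_trans gint _; rewrite ltry.
have iBD : lam.-integrable D (fun x => (\1_B x)%:E).
  apply/integrableP; split.
    by apply/measurable_EFinP; exact: measurable_indic.
  under eq_integral do rewrite gee0_abs ?lee_fin//.
  by rewrite lamB ltry.
have : (0 <= \int[lam]_(x in D) ((alpha^-1 * g (x - t))%:E - (c * \1_B x)%:E))%E.
  rewrite -F0; apply: le_integral => //.
    apply: integrableB => //; first by under eq_fun do rewrite EFinM; exact: integrableZl.
    by under eq_fun do rewrite EFinM; exact: integrableZl.
  move=> x; rewrite inE => Dx; rewrite lee_fin indicE.
  case: (boolP (x \in B)) => [|_]; last by rewrite mulr0 subr0 Fg.
  rewrite inE => Bx; rewrite mulr1; apply: le_trans (FB x Bx) _.
  by rewrite lerDr mulr_ge0 ?invr_ge0 ?(ltW alpha0).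
rewrite integralB_EFin//; last 2 first.
- by rewrite /comp; under eq_fun do rewrite EFinM; exact: integrableZl.
- by rewrite /comp; under eq_fun do rewrite EFinM; exact: integrableZl.
under eq_integral do rewrite EFinM.
rewrite integralZl//.
under [X in (_ <= _ - X)%E]eq_integral do rewrite EFinM.
rewrite integralZl// lamB -(fineK (integrable_fin_num mD igD)) -!EFinM -EFinB lee_fin.
rewrite subr_ge0 => cvol.
have gC : fine (\int[lam]_(x in D) (g (x - t))%:E)%E <= C.
  by rewrite -lee_fin fineK// integrable_fin_num.
move: alphaC; rewrite ltr_pdivrMr ?mulr_gt0//; apply/negP; rewrite -leNgt.
rewrite -ler_pdivlMl//; apply: le_trans cvol _.
by rewrite ler_pM2l ?invr_gt0.
Qed.

(** A small tilt at [t] cannot compensate the growth of the divergence away from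
[t], so the density exceeds its value at [t] only near [t]. *)
Lemma mode_near_mean : exists2 rho : R, 0 < rho &
  forall eps : R, 0 < eps -> exists2 d : R, 0 < d &
  forall alpha beta t h, 0 < alpha -> `|t - x0| < rho -> D h ->
  gibbs alpha beta t <= gibbs alpha beta h ->
  `|gradient f t - alpha^-1 *: beta| < d -> `|h - t| < eps.
Proof.
have [k [L [rho [k0 L0 rho0 H]]]] := breg_growth oD C2 Dx0 pH convf.
exists rho => // eps eps0.
have me0 : 0 < Num.min eps rho by rewrite lt_min eps0.
exists (k * Num.min eps rho / (m%:R + 1)).
  by rewrite divr_gt0 ?mulr_gt0// ltr_wpDl.
move=> alpha beta t h alpha0 tx Dh th; set v := gradient f t - _ => vd.
rewrite ltNge; apply/negP => zeps.
have z0 : 0 < `|h - t| by exact: lt_le_trans zeps.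
have [Dt _ growth _] := H _ tx.
move: th; rewrite (gibbs_breg beta t h (lt0r_neq0 alpha0)) -/v.
rewrite -[leLHS]mulr1 ler_pM2l ?expR_gt0// -[leLHS]expR0 ler_expR oppr_ge0.
rewrite pmulr_rle0// -lerBrDr sub0r => bz.
have := le_trans (growth _ Dh) bz; apply/negP; rewrite -ltNge.
apply: (@le_lt_trans _ _ (m%:R * `|h - t| * `|v|)).
  by rewrite -dotNl (le_trans (ler_norm _))// (le_trans (dot_le_norm _ _))// normrN.
rewrite mulrAC mulrA ltr_pM2r//.
have h1 : (m%:R + 1) * `|v| < k * Num.min eps rho.
  by move: vd; rewrite ltr_pdivlMr ?ltr_wpDl// mulrC.
apply: (@lt_le_trans _ _ (k * Num.min eps rho)).
  apply: le_lt_trans h1; rewrite ler_wpM2r// lerDl//.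
rewrite ler_pM2l// le_min; apply/andP; split; last by rewrite ge_min lexx orbT.
by rewrite ge_min zeps.
Qed.

(** A step of length proportional to [s] against a nonzero gradient increases the
exponent to first order in [s] and decreases it only to second order. *)
Lemma mode_stationary : exists2 rho : R, 0 < rho &
  forall alpha beta h, 0 < alpha -> `|h - x0| < rho ->
  (forall x, D x -> gibbs alpha beta x <= gibbs alpha beta h) ->
  gradient f h = alpha^-1 *: beta.
Proof.
have [k [L [rho [k0 L0 rho0 H]]]] := breg_growth oD C2 Dx0 pH convf.
exists rho => // alpha beta h alpha0 hx hmax.
have [Dh _ _ upper] := H _ hx.
apply/eqP; rewrite -subr_eq0; set v := gradient f h - _.
apply/negPn/negP => v0.
have nv : 0 < `|v| by rewrite normr_gt0.
pose s := Num.min (rho / (2 * `|v|)) (1 / (2 * L)).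
have s0 : 0 < s by rewrite lt_min !divr_gt0// mulr_gt0.
have s1 : s * `|v| < rho.
  apply: (@le_lt_trans _ _ (rho / 2)); last by lra.
  rewrite -ler_pdivlMr// -mulrA -invfM.
  by rewrite ge_min lexx.
have s2 : s * L <= 1 / 2.
  rewrite -ler_pdivlMr// -mulrA -invfM.
  by rewrite ge_min lexx orbT.
have [|Dz bz] := upper (- s *: v).
  by rewrite normrZ normrN gtr0_norm.
have := hmax _ Dz; apply/negP; rewrite -ltNge.
rewrite (gibbs_breg beta h (h + - s *: v) (lt0r_neq0 alpha0)) -/v.
rewrite -[ltLHS]mulr1 ltr_pM2l ?expR_gt0// -[ltLHS]expR0 ltr_expR oppr_gt0.
rewrite pmulr_rlt0// [h + _]addrC addrK dotZl.
apply: (@le_lt_trans _ _ (L * `|- s *: v| ^+ 2 + - s * dot v v)).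
  by rewrite lerD2r addrC.
rewrite normrZ normrN gtr0_norm// mulNr subr_lt0.
rewrite (_ : L * _ = s * (s * L * `|v| ^+ 2)); last by ring.
rewrite ltr_pM2l//; apply: lt_le_trans (norm_le_dot v).
rewrite gtr_pMl ?exprn_gt0//; lra.
Qed.

End posterior.

(** * Laplace's method in whitened coordinates *)

Lemma open_continuous_measurable (R : realType) m (D : set 'rV[R]_m) (f : 'rV[R]_m -> R) :
  open D -> (forall x, D x -> {for x, continuous f}) -> measurable_fun D f.
Proof.
move=> oD cf; apply: (measurability _ (RGenOpens.measurableE R)).
move=> _ [_ [a [b ->] <-]]; apply: measurable_row_open.
rewrite openE => x [Dx fx]; apply: filterI; first exact: open_nbhs_nbhs.
by apply: cf => //; apply: open_nbhs_nbhs.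
Qed.

Section sqrt_inverse.
Context {R : realType} {m : nat}.

Lemma posdefmx_scale (c : R) (A : 'M[R]_m) : 0 < c -> posdefmx A -> posdefmx (c *: A).
Proof.
move=> c0 [sA pA]; split; first by rewrite linearZ/= sA.
by move=> v v0; rewrite -scalemxAr dotZl mulr_gt0// pA.
Qed.

Lemma posdefmx_inv (A : 'M[R]_m) : posdefmx A -> posdefmx (invmx A).
Proof.
move=> pA; have uA := posdefmx_unit pA; have [sA pos] := pA.
split; first by rewrite trmx_inv sA.
move=> v v0; pose w := v *m invmx A.
have vE : v = w *m A by rewrite /w mulmxKV.
rewrite -/w vE dotC; apply: pos.
by apply: contra_neq v0 => w0; rewrite vE w0 mul0mx.
Qed.

(** In the coordinates [x = y S] with [S = A^(-1/2)] the form of [A] is the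
squared length. *)
Lemma sqrt_inv_whitens (A : 'M[R]_m) : posdefmx A ->
  sqrtmx (invmx A) \in unitmx /\
  forall y, dot ((y *m sqrtmx (invmx A)) *m A) (y *m sqrtmx (invmx A)) = dot y y.
Proof.
move=> pA; have [pS SS] := sqrtmxP (posdefmx_inv pA).
have uS := posdefmx_unit pS; split => // y; have [sS _] := pS.
set S := sqrtmx _ in SS uS sS *.
have SA : S *m A = invmx S.
  have : S *m (S *m A) = 1%:M by rewrite mulmxA SS mulVmx// posdefmx_unit.
  by move=> /(congr1 (mulmx (invmx S))); rewrite mulKmx// mulmx1.
by rewrite -[y *m S *m A]mulmxA SA dotC dot_mulmx sS mulmxKV.
Qed.

End sqrt_inverse.

Section laplace.
Context {R : realType} {m : nat}.
Variables (D : set 'rV[R]_m) (f : 'rV[R]_m -> R) (x0 : 'rV[R]_m).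
Hypotheses (oD : open D) (C2 : Ck 2 D f) (Dx0 : D x0).
Hypothesis pH : posdefmx (hessian f x0).
Hypothesis convf : segment_convex D f.
Local Notation lam := (@lebesgue_row R m).
Local Notation breg := (breg f).

Definition bump (alpha : R) (a : 'rV[R]_m) : 'rV[R]_m -> R :=
  (fun x => expR (- (alpha * breg a x))) \_ D.

(** [S] turns the quadratic form of the posterior precision at [a] into the squared
length. Since this holds exactly for every [n], the limit of the whitened
integrals does not depend on how [S] varies. *)
Definition whitens (alpha : R) (a : 'rV[R]_m) (S : 'M[R]_m) :=
  forall y, alpha * dot ((y *m S) *m hessian f a) (y *m S) = dot y y.

Lemma measurable_bump alpha a : measurable_fun setT (bump alpha a).
Proof.
have mD := measurable_row_open oD.
apply/(measurable_restrictT _ mD).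
apply: measurableT_comp => //; apply: measurableT_comp => //.
apply: measurable_funM => //; apply: measurable_funB.
  apply: measurable_funB => //; apply: open_continuous_measurable => //.
  by have [] := C2.
apply: measurable_funTS; apply: measurable_dot => //.
by apply: measurable_rowB; [exact: measurable_id|exact: measurable_cst].
Qed.

Lemma bump_ge0 alpha a x : 0 <= bump alpha a x.
Proof. by rewrite /bump patchE; case: ifP => // _; exact: expR_ge0. Qed.

(** One integrable majorant for all large precisions. With [u = sqrt alpha |z|],
the growth of the divergence gives an exponent of at least
[k (rho u - rho^2)], and [u] is at least [|y|] divided by [sqrt L]. *)
Lemma bump_le : exists rho c0 c1 : R, [/\ 0 < rho, 0 < c1 &
  forall alpha a S, 1 <= alpha -> `|a - x0| < rho -> whitens alpha a S ->
  forall y, bump alpha a (y *m S + a) <= expR c0 * expR (- c1 * `|y|)].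
Proof.
have [k [L [rho [k0 L0 rho0 H]]]] := breg_growth oD C2 Dx0 pH convf.
pose l := Num.sqrt L.
have l0 : 0 < l by rewrite sqrtr_gt0.
exists rho, (k * rho ^+ 2), (k * (rho / l)); split => //.
  by rewrite !mulr_gt0// invr_gt0.
move=> alpha a S alpha1 ax wS y; rewrite -expRD /bump patchE.
case: ifPn => [|_]; last exact: expR_ge0.
rewrite inE ler_expR => DyS.
have [_ quad growth _] := H _ ax.
have := growth _ DyS; rewrite addrK; set z := y *m S => gz.
have alpha0 : 0 < alpha by lra.
pose s := Num.sqrt alpha.
have ss : s ^+ 2 = alpha by rewrite sqr_sqrtr// ltW.
have s1 : 1 <= s by rewrite -[leLHS]sqrtr1 ler_wsqrtr.
have s0 : 0 <= s by exact: le_trans s1.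
pose u := s * `|z|.
have u0 : 0 <= u by rewrite mulr_ge0.
have yu : `|y| / l <= u.
  rewrite ler_pdivrMr// -(@ler_pXn2r _ 2) ?nnegrE ?mulr_ge0// ?(ltW l0)//.
  apply: le_trans (norm_le_dot y) _; rewrite -wS.
  have /andP[_ qz] := quad z; apply: le_trans (ler_wpM2l (ltW alpha0) qz) _.
  by rewrite /u !exprMn ss sqr_sqrtr ?(ltW L0)// mulrAC mulrA mulrAC.
have h1 : Num.min u rho * u <= alpha * (Num.min `|z| rho * `|z|).
  rewrite -ss /u; have [zr|zr] := leP `|z| rho.
    by rewrite expr2 mulrACA ler_wpM2r// ge_min lexx.
  rewrite [leRHS](_ : _ = (s * rho) * (s * `|z|)); last by ring.
  rewrite ler_wpM2r// ge_min; apply/orP; right.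
  by rewrite ler_peMl// ltW.
have h2 := min_mul_ge u0 (ltW rho0).
have h3 := ler_wpM2l (ltW rho0) yu.
have h4 := ler_wpM2l (ltW alpha0) gz.
have h5 : k * (rho * (`|y| / l) - rho ^+ 2) <= k * (alpha * (Num.min `|z| rho * `|z|)).
  by rewrite ler_pM2l//; lra.
rewrite lerNl; apply: (le_trans _ h4); rewrite [leRHS]mulrCA; apply: (le_trans _ h5).
by rewrite le_eqVlt; apply/orP; left; apply/eqP; ring.
Qed.

(** The divergence is half its quadratic form up to [o(|z|^2)], and
[alpha |z|^2] is bounded by a multiple of [dot y y]. *)
Lemma bump_lim y (eps : R) : 0 < eps -> exists2 r : R, 0 < r &
  exists A : R, forall alpha a S, A < alpha -> `|a - x0| < r -> whitens alpha a S ->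
  D (y *m S + a) /\ `|alpha * breg a (y *m S + a) - dot y y / 2| <= eps.
Proof.
move=> eps0.
have [k [L [rho [k0 L0 rho0 H]]]] := breg_growth oD C2 Dx0 pH convf.
pose q := dot y y.
have q0 : 0 <= q := dot_ge0 y.
have eps'0 : 0 < eps * k / (q + 1) by rewrite divr_gt0 ?mulr_gt0// ltr_wpDl.
have [r r0 quad] := breg_quad oD C2 Dx0 eps'0.
pose r' := Num.min r rho.
have r'0 : 0 < r' by rewrite lt_min r0.
exists r' => //; exists (Num.max 0 (q / (k * r' ^+ 2))) => alpha a S.
rewrite gt_max => /andP[alpha0 alphaA]; rewrite /r' lt_min => /andP[ar arho] wS.
set z := y *m S.
have [_ qa _ upper] := H _ arho.
have az : alpha * (k * `|z| ^+ 2) <= q.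
  by rewrite /q -wS ler_pM2l//; have /andP[] := qa z.
have zr' : `|z| < r'.
  rewrite -(@ltr_pXn2r _ 2) ?nnegrE ?(ltW r'0)//.
  rewrite -(ltr_pM2l k0) -(ltr_pM2l alpha0); apply: le_lt_trans az _.
  by rewrite -ltr_pdivrMr// mulr_gt0// exprn_gt0.
move: zr'; rewrite /r' lt_min => /andP[zr zrho].
have [Dz _] := upper _ zrho.
rewrite [z + a]addrC; split => //.
rewrite -wS -mulrA -mulrBr normrM gtr0_norm//.
apply: le_trans (ler_wpM2l (ltW alpha0) (quad _ _ ar zr)) _.
rewrite (_ : alpha * _ = eps / (q + 1) * (alpha * (k * `|z| ^+ 2))); last by ring.
apply: le_trans (ler_wpM2l _ az) _; first by rewrite divr_ge0 ?(ltW eps0)// addr_ge0.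
rewrite mulrAC ler_pdivrMr ?ltr_wpDl// ler_pM2l//; lra.
Qed.

End laplace.

Section laplace_limit.
Context {R : realType} {m : nat}.
Variables (D : set 'rV[R]_m) (f : 'rV[R]_m -> R) (x0 : 'rV[R]_m).
Hypotheses (oD : open D) (C2 : Ck 2 D f) (Dx0 : D x0).
Hypothesis pH : posdefmx (hessian f x0).
Hypothesis convf : segment_convex D f.
Local Notation lam := (@lebesgue_row R m).
Local Notation breg := (breg f).
Local Notation bump := (bump D f).

(** Dominated convergence with the limit [bump_lim] and the majorant [bump_le]. *)
Lemma laplace (g : 'rV[R]_m -> R) (B : R) (al : R^nat)
    (a : nat -> 'rV[R]_m) (S : nat -> 'M[R]_m) :
  measurable_fun setT g -> (forall x, 0 <= g x <= B) ->
  al n @[n --> \oo] --> +oo -> a n @[n --> \oo] --> x0 ->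
  (\forall n \near \oo, whitens f (al n) (a n) (S n)) ->
  (\int[lam]_y (g y * bump (al n) (a n) (y *m S n + a n))%:E)%E @[n --> \oo] -->
  (\int[lam]_y (g y * expR (- dot y y / 2))%:E)%E.
Proof.
move=> mg gB alo ax wS.
have [rho [c0 [c1 [rho0 c10 bnd]]]] := bump_le oD C2 Dx0 pH convf.
have : \forall n \near \oo, [/\ 1 <= al n, `|a n - x0| < rho & whitens f (al n) (a n) (S n)].
  near=> n; split; near: n => //.
  - by move/cvgryPge : alo; exact.
  - by move/cvgr_distC_lt : ax => /(_ _ rho0).
move=> [N _ HN].
rewrite -(cvg_shiftn N).
pose F n y := (g y * bump (al (n + N)%N) (a (n + N)%N) (y *m S (n + N)%N + a (n + N)%N))%:E.
have HN' n := HN (n + N)%N (leq_addl _ _).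
have [//|//|||//|_ _] := @dominated_convergence _ _ _ lam setT measurableT F
  (fun y => (g y * expR (- dot y y / 2))%:E)
  (fun y => ((B * expR c0) * expR (- c1 * `|y|))%:E).
- move=> n; apply/measurable_EFinP; apply: measurable_funM => //.
  apply: (measurableT_comp (measurable_bump oD C2 _ _)).
  by apply: measurable_rowD => //; exact: measurable_rowM.
- apply/measurable_EFinP; apply: measurable_funM => //.
  apply: measurableT_comp => //; apply: measurable_funM => //.
  by apply: measurableT_comp => //; apply: measurable_dot.
- apply: aeW => y _; rewrite /F; apply: cvg_EFin; first by near=> n.
  apply: cvgM; first exact: cvg_cst.
  have alN : al (n + N)%N @[n --> \oo] --> +oo by rewrite (cvg_shiftn N).
  have axN : a (n + N)%N @[n --> \oo] --> x0 by rewrite (cvg_shiftn N).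
  pose z n := y *m S (n + N)%N + a (n + N)%N.
  have near_lim (eps : R) : 0 < eps -> \forall n \near \oo, D (z n) /\
      `|al (n + N)%N * breg (a (n + N)%N) (z n) - dot y y / 2| <= eps.
    move=> eps0; have [r r0 [A rA]] := bump_lim oD C2 Dx0 pH convf y eps0.
    near=> n; apply: rA; last by have [] := HN' n.
    - by near: n; move/cvgryPgt : alN; exact.
    - by near: n; move/cvgr_distC_lt : axN => /(_ _ r0).
  have lim1 : al (n + N)%N * breg (a (n + N)%N) (z n) @[n --> \oo] --> dot y y / 2.
    apply/cvgrPdist_le => eps /near_lim; apply: filterS => n [_].
    by rewrite distrC.
  have lim2 : expR (- (al (n + N)%N * breg (a (n + N)%N) (z n))) @[n --> \oo]
      --> expR (- dot y y / 2).
    rewrite mulNr; apply: continuous_cvg; first exact: continuous_expR.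
    exact: cvgN.
  apply: cvg_trans lim2; apply: near_eq_cvg.
  apply: filterS (near_lim 1 ltr01) => n [Dz _].
  by rewrite /bump patchE mem_set.
- under eq_fun do rewrite EFinM; apply: integrableZl => //.
  exact: integrable_exp_norm.
- apply: aeW => y n _; rewrite lee_fin ger0_norm ?mulr_ge0 ?bump_ge0//; last first.
    by have /andP[] := gB y.
  have [h1 h2 h3] := HN' n.
  have /andP[gy0 gyB] := gB y.
  rewrite -mulrA; apply: ler_pM => //; first exact: bump_ge0.
  exact: bnd.
- by [].
Unshelve. all: by end_near. Qed.

Lemma whiten_integral (alpha : R) (a : 'rV[R]_m) (S : 'M[R]_m) : S \in unitmx ->
  exists2 c : R, 0 < c & forall g : 'rV[R]_m -> R,
    measurable_fun setT g -> (forall x, 0 <= g x) ->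
    (\int[lam]_(x in D) (g ((x - a) *m invmx S) * expR (- (alpha * breg a x)))%:E =
     c%:E * \int[lam]_y (g y * bump alpha a (y *m S + a))%:E)%E.
Proof.
move=> uS; have [c c0 cP] := ge0_integral_linear uS.
exists c^-1; first by rewrite invr_gt0.
move=> g mg g0.
have mb := measurable_bump oD C2 alpha a.
pose h x := (g (x *m invmx S) * bump alpha a (x + a))%:E.
have mh : measurable_fun setT h.
  apply/measurable_EFinP; apply: measurable_funM.
    exact: measurableT_comp mg (measurable_mulmx _).
  apply: measurableT_comp mb _.
  by apply: measurable_rowD; [exact: measurable_id|exact: measurable_cst].
have h0 x : (0 <= h x)%E by rewrite lee_fin mulr_ge0 ?bump_ge0.
have -> : (\int[lam]_y (g y * bump alpha a (y *m S + a))%:E = \int[lam]_y h (y *m S))%E.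
  by apply: eq_integral => y _; rewrite /h mulmxK.
rewrite cP// muleA -EFinM mulVf ?gt_eqF// mul1e.
rewrite -(ge0_integral_translation (- a) mh)// integral_mkcond.
apply: eq_integral => x _; rewrite /h subrK /bump !patchE.
by case: ifP => // _; rewrite mulr0.
Qed.

End laplace_limit.

(** * Convexity of the log-partition function *)

Section log_partition.
Context {R : realType} {m d p : nat} (M : vb_model R m d p).

Lemma expR_convex (s a b : R) : 0 <= s <= 1 ->
  expR ((1 - s) * a + s * b) <= (1 - s) * expR a + s * expR b.
Proof.
move=> /andP[s0 s1]; set r := (1 - s) * a + s * b.
have tangent c : expR r * (1 + (c - r)) <= expR c.
  have -> : expR c = expR r * expR (c - r) by rewrite -expRD subrKC.
  by rewrite ler_pM2l ?expR_gt0// expR_ge1Dx.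
have ha := ler_wpM2l (_ : 0 <= 1 - s) (tangent a).
have hb := ler_wpM2l s0 (tangent b).
apply: le_trans (lerD (ha _) hb); last by rewrite subr_ge0.
by rewrite le_eqVlt; apply/orP; left; apply/eqP; rewrite /r; ring.
Qed.

Hypothesis base_ge0 : forall x y, 0 <= base M x y.
Hypothesis base_meas : measurable_fun setT (fun z => base M z.1 z.2).
Hypothesis suff_meas : measurable_fun setT (fun z => suff M z.1 z.2).
Hypothesis joint_density1 : forall theta, Theta M theta ->
  (\int[(lebesgue_row d \x lebesgue_row p)%E]_z
     (joint_density M theta z.1 z.2)%:E = 1)%E.

(** Both densities integrate to 1, hence so does their mixture with weights
[1 - s] and [s]. By convexity of the exponential the mixture dominates the
density at the intermediate parameter times the exponential of the convexity
defect, which is therefore at most 1. *)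
Lemma log_partition_convex : segment_convex (Theta M) (psi M).
Proof.
move=> a b s s01 Ta Tb Tc; set c := a + s *: (b - a).
pose J theta (z : 'rV[R]_d * 'rV[R]_p) := joint_density M theta z.1 z.2.
have mJ theta : measurable_fun setT (fun z => (J theta z)%:E).
  apply/measurable_EFinP; apply: measurable_funM => //.
  apply: measurableT_comp => //; apply: measurable_funB => //.
  by apply: measurable_dot.
have J0 theta z : 0 <= J theta z by rewrite mulr_ge0// expR_ge0.
have [s0 s1] := andP s01.
have s1' : 0 <= 1 - s by rewrite subr_ge0.
pose r := psi M c - ((1 - s) * psi M a + s * psi M b).
have key z : expR r * J c z <= (1 - s) * J a z + s * J b z.
  rewrite /J /joint_density; set u := suff M _ _.
  rewrite [leLHS]mulrCA [X in _ <= X + _]mulrCA [X in _ <= _ + X]mulrCA -mulrDr.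
  apply: ler_wpM2l => //; rewrite -expRD.
  rewrite (_ : r + _ = (1 - s) * (dot a u - psi M a) + s * (dot b u - psi M b)).
    exact: expR_convex.
  rewrite /r [dot c u]dotDl dotZl dotBl; ring.
suff : expR r <= 1 by rewrite -[leRHS]expR0 ler_expR subr_le0.
rewrite -lee_fin.
have -> : (expR r)%:E = (\int[(lebesgue_row d \x lebesgue_row p)%E]_z
    ((expR r)%:E * (J c z)%:E))%E.
  rewrite ge0_integralZl//; last by move=> z _; rewrite lee_fin.
  by rewrite joint_density1// mule1.
have -> : 1%E = (\int[(lebesgue_row d \x lebesgue_row p)%E]_z
    ((1 - s)%:E * (J a z)%:E + s%:E * (J b z)%:E))%E.
  rewrite ge0_integralD//; last 4 first.
  - by move=> z _; rewrite -EFinM lee_fin mulr_ge0.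
  - exact: measurable_funeM.
  - by move=> z _; rewrite -EFinM lee_fin mulr_ge0.
  - exact: measurable_funeM.
  rewrite !ge0_integralZl//; try by move=> z _; rewrite lee_fin.
  by rewrite !joint_density1// !mule1 -EFinD subrK.
apply: ge0_le_integral => //.
- by move=> z _; rewrite -EFinM lee_fin mulr_ge0// expR_ge0.
- exact: measurable_funeM.
- by apply: emeasurable_funD; exact: measurable_funeM.
- by move=> z _; rewrite -!EFinM -EFinD lee_fin.
Qed.

End log_partition.

(** * Asymptotic normality *)

Section bernstein_von_mises.
Context {R : realType} {m : nat}.
Variables (D : set 'rV[R]_m) (f : 'rV[R]_m -> R) (x0 : 'rV[R]_m).
Hypotheses (oD : open D) (C2 : Ck 2 D f) (Dx0 : D x0).
Hypothesis pH : forall x, D x -> posdefmx (hessian f x).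
Hypothesis convf : segment_convex D f.
Local Notation lam := (@lebesgue_row R m).
Local Notation breg := (breg f).
Local Notation bump := (bump D f).

Lemma measurable_gibbs alpha beta : measurable_fun D (gibbs f alpha beta).
Proof.
apply: measurableT_comp => //; apply: measurable_funB.
  by apply: measurable_funTS; apply: measurable_dot.
apply: measurable_funM => //; apply: open_continuous_measurable => //.
by have [] := C2.
Qed.

(** The normalising constant and the Jacobian both cancel: applying the same
formula to the constant function 1 evaluates their product. *)
Lemma whitened_expectation d (T : measurableType d) (Q : probability T R)
    (X : {RV Q >-> 'rV[R]_m}) (alpha nu : R) (beta a : 'rV[R]_m) (S : 'M[R]_m)
    (g : 'rV[R]_m -> R) :
  0 < alpha -> 0 <= nu -> S \in unitmx -> gradient f a = alpha^-1 *: beta ->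
  has_density X D (fun x => (nu * gibbs f alpha beta x)%:E) ->
  measurable_fun setT g -> (forall x, 0 <= g x) ->
  (\int[Q]_s (g ((X s - a) *m invmx S))%:E =
   ((fine (\int[lam]_y (1 * bump alpha a (y *m S + a))%:E))^-1)%:E *
   \int[lam]_y (g y * bump alpha a (y *m S + a))%:E)%E.
Proof.
move=> alpha0 nu0 uS grad_a densX mg g0.
have mD := measurable_row_open oD.
have [c c0 cP] := whiten_integral oD C2 alpha a uS.
pose K := nu * gibbs f alpha beta a.
have K0 : 0 <= K by rewrite mulr_ge0// expR_ge0.
have gE x : nu * gibbs f alpha beta x = K * expR (- (alpha * breg a x)).
  rewrite (gibbs_breg f beta a x (lt0r_neq0 alpha0)) grad_a subrr.
  by rewrite [dot _ 0]dotC dot0l addr0 mulrA.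
have maff : measurable_fun setT (fun x : 'rV[R]_m => (x - a) *m invmx S).
  apply: measurable_rowM.
  by apply: measurable_rowB; [exact: measurable_id|exact: measurable_cst].
have mge : measurable_fun D (fun x => expR (- (alpha * breg a x))).
  have := measurable_bump oD C2 alpha a.
  by move=> /(measurable_restrictT _ mD).
have expect (h : 'rV[R]_m -> R) : measurable_fun setT h -> (forall x, 0 <= h x) ->
  (\int[Q]_s (h ((X s - a) *m invmx S))%:E =
   (K * c)%:E * \int[lam]_y (h y * bump alpha a (y *m S + a))%:E)%E.
  move=> mh h0.
  have mhx : measurable_fun setT (fun x : 'rV[R]_m => (h ((x - a) *m invmx S))%:E).
    by apply/measurable_EFinP; exact: measurableT_comp mh maff.
  rewrite -(ge0_integral_distribution X mhx); last by move=> x; rewrite lee_fin.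
  rewrite (ge0_integral_density mD _ _ densX mhx).
  - rewrite EFinM -muleA -cP// -ge0_integralZl//.
    + by apply: eq_integral => x _; rewrite -!EFinM gE mulrCA.
    + apply/measurable_EFinP; apply: measurable_funM => //.
      apply: measurable_funTS; exact: measurableT_comp mh maff.
    + by move=> x _; rewrite lee_fin mulr_ge0// expR_ge0.
  - by apply: measurable_funM => //; exact: measurable_gibbs.
  - by move=> x _; rewrite mulr_ge0// expR_ge0.
  - by move=> x; rewrite lee_fin.
have one := expect (fun=> 1) (measurable_cst _) (fun=> ler01).
have Q1 : (\int[Q]_s 1%:E = 1)%E.
  by rewrite integral_cst//= probability_setT mul1e.
rewrite Q1 in one.
rewrite expect//; congr (_ * _)%E.
have Kc : K * c != 0.
  by apply/eqP => e; move: one; rewrite e mul0e => /eqP; rewrite onee_eq0.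
have -> : (\int[lam]_y (1 * bump alpha a (y *m S + a))%:E = ((K * c)^-1)%:E)%E.
  by rewrite -[RHS]mule1 one muleA -EFinM mulVf// mul1e.
by rewrite /= invrK.
Qed.

Section asymptotics.
Variables (al : R^nat) (be t a : nat -> 'rV[R]_m).
Hypothesis al_oo : al n @[n --> \oo] --> +oo.
Hypothesis t_x0 : t n @[n --> \oo] --> x0.
Hypothesis mean_t : \forall n \near \oo, [/\
  lam.-integrable D (fun x => (gibbs f (al n) (be n) x)%:E),
  forall j, lam.-integrable D (fun x => (x ord0 j * gibbs f (al n) (be n) x)%:E) &
  forall j, \int[lam]_(x in D) (x ord0 j * gibbs f (al n) (be n) x) =
            t n ord0 j * \int[lam]_(x in D) gibbs f (al n) (be n) x].
Hypothesis mode_a : \forall n \near \oo, D (a n) /\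
  forall x, D x -> gibbs f (al n) (be n) x <= gibbs f (al n) (be n) (a n).

(** The equilibrium point is the mean, so the tilt vanishes there asymptotically,
and then the mode is close to the mean. *)
Lemma mode_cvg : a n @[n --> \oo] --> x0.
Proof.
have [rho1 rho10 mean] := mean_gradient oD C2 Dx0 (pH Dx0) convf.
have [rho2 rho20 mode] := mode_near_mean oD C2 Dx0 (pH Dx0) convf.
apply/cvgrPdist_lt => eps eps0.
have eps20 : 0 < eps / 2 by rewrite divr_gt0.
have [del del0 close] := mode _ eps20.
have [A meanA] := mean _ del0.
have near_t (r : R) : 0 < r -> \forall n \near \oo, `|t n - x0| < r.
  by move=> r0; move/cvgr_distC_lt : t_x0 => /(_ _ r0).
have near_al (B : R) : \forall n \near \oo, B < al n by move/cvgryPgt : al_oo; exact.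
near=> n.
have [iK ixK mK] : [/\ lam.-integrable D (fun x => (gibbs f (al n) (be n) x)%:E),
  forall j, lam.-integrable D (fun x => (x ord0 j * gibbs f (al n) (be n) x)%:E) &
  forall j, \int[lam]_(x in D) (x ord0 j * gibbs f (al n) (be n) x) =
            t n ord0 j * \int[lam]_(x in D) gibbs f (al n) (be n) x].
  by near: n.
have [Da amax] : D (a n) /\
    forall x, D x -> gibbs f (al n) (be n) x <= gibbs f (al n) (be n) (a n).
  by near: n.
have tx1 : `|t n - x0| < rho1 by near: n; exact: near_t.
have tx2 : `|t n - x0| < rho2 by near: n; exact: near_t.
have tx3 : `|t n - x0| < eps / 2 by near: n; exact: near_t.
have Dt : D (t n).
  near: n; apply: t_x0; exact: open_nbhs_nbhs.
have alA : A < al n by near: n; exact: near_al.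
have al0 : 0 < al n by near: n; exact: near_al.
have h := close (al n) (be n) (t n) (a n) al0 tx2 Da (amax _ Dt)
  (meanA (al n) (be n) (t n) alA tx1 iK ixK mK).
rewrite distrC -(subrKA (t n)).
by rewrite (le_lt_trans (ler_normD _ _))// (splitr eps) ltrD.
Unshelve. all: by end_near. Qed.

Lemma near_stationary : \forall n \near \oo, [/\ D (a n), 0 < al n &
  gradient f (a n) = (al n)^-1 *: be n].
Proof.
have [rho rho0 stat] := mode_stationary oD C2 Dx0 (pH Dx0) convf.
have near_a : \forall n \near \oo, `|a n - x0| < rho.
  by move/cvgr_distC_lt : mode_cvg => /(_ _ rho0).
near=> n.
have [Da amax] : D (a n) /\
    forall x, D x -> gibbs f (al n) (be n) x <= gibbs f (al n) (be n) (a n).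
  by near: n.
have al0 : 0 < al n by near: n; move/cvgryPgt : al_oo; exact.
split => //; apply: stat => //.
by near: n.
Unshelve. all: by end_near. Qed.

Let S n := sqrtmx (invmx (al n *: hessian f (a n))).

Lemma near_whitens : \forall n \near \oo, S n \in unitmx /\ whitens f (al n) (a n) (S n).
Proof.
apply: filterS near_stationary => n [Da al0 _].
have [uS wS] := sqrt_inv_whitens (posdefmx_scale al0 (pH Da)).
by split => // y; rewrite -dotZl scalemxAr wS.
Qed.

Lemma posterior_cvg_ge0 (dT : measure_display) (T : nat -> measurableType dT)
    (Q : forall n, probability (T n) R) (X : forall n, {RV (Q n) >-> 'rV[R]_m})
    (nu : R^nat) (g : 'rV[R]_m -> R) (B : R) :
  (\forall n \near \oo, 0 <= nu n /\
    has_density (X n) D (fun x => (nu n * gibbs f (al n) (be n) x)%:E)) ->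
  measurable_fun setT g -> (forall x, 0 <= g x <= B) ->
  (\int[Q n]_s (g ((X n s - a n) *m invmx (S n)))%:E)%E @[n --> \oo] -->
  (\int[lam]_x (g x * std_normal_pdf x)%:E)%E.
Proof.
move=> dens mg gB.
have g0 x : 0 <= g x by have /andP[] := gB x.
have near_w : \forall n \near \oo, whitens f (al n) (a n) (S n).
  by apply: filterS near_whitens => n [].
pose G n := (\int[lam]_y (g y * bump (al n) (a n) (y *m S n + a n))%:E)%E.
pose Z n := (\int[lam]_y (1 * bump (al n) (a n) (y *m S n + a n))%:E)%E.
have cG := laplace oD C2 Dx0 (pH Dx0) convf mg gB al_oo mode_cvg near_w.
have one01 (x : 'rV[R]_m) : 0 <= (fun=> 1 : R) x <= 1 by rewrite ler01 lexx.
have := laplace oD C2 Dx0 (pH Dx0) convf (measurable_cst (1 : R)) one01 al_oo mode_cvg near_w.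
under [X in _ --> X]eq_integral do rewrite mul1r.
rewrite integral_std_gauss -/(Z _) => cZ.
set r := Num.sqrt (2 * pi) ^+ m in cZ.
have r0 : r != 0 by rewrite expf_neq0// gt_eqF// sqrtr_gt0 mulr_gt0// pi_gt0.
have cZr : (fine (Z n))^-1 @[n --> \oo] --> r^-1.
  by apply: cvgV => //; exact: fine_cvg cZ.
have -> : (\int[lam]_x (g x * std_normal_pdf x)%:E =
    r^-1%:E * \int[lam]_y (g y * expR (- dot y y / 2))%:E)%E.
  rewrite -ge0_integralZl//.
  - apply: eq_integral => x _; rewrite -EFinM /std_normal_pdf mulrCA; congr (_ * _)%:E.
  - apply/measurable_EFinP; apply: measurable_funM => //.
    apply: measurableT_comp => //; apply: measurable_funM => //.
    by apply: measurableT_comp => //; exact: measurable_dot.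
  - by move=> x _; rewrite lee_fin mulr_ge0// expR_ge0.
  - by rewrite lee_fin invr_ge0 exprn_ge0// sqrtr_ge0.
have : (((fine (Z n))^-1)%:E * G n)%E @[n --> \oo] -->
    (r^-1%:E * \int[lam]_y (g y * expR (- dot y y / 2))%:E)%E.
  apply: cvgeM => //; last first.
    by apply: cvg_EFin => //; exact: nearW.
  by rewrite /mule_def; case: (integral _ _ _) => //=; rewrite invr_eq0.
apply: cvg_trans; apply: near_eq_cvg.
near=> n.
have [Da al0 grad_a] : [/\ D (a n), 0 < al n & gradient f (a n) = (al n)^-1 *: be n].
  by near: n; exact: near_stationary.
have [uS wS] : S n \in unitmx /\ whitens f (al n) (a n) (S n).
  by near: n; exact: near_whitens.
have [nu0 densX] : 0 <= nu n /\
    has_density (X n) D (fun x => (nu n * gibbs f (al n) (be n) x)%:E) by near: n.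
by rewrite (whitened_expectation al0 nu0 uS grad_a densX mg g0).
Unshelve. all: by end_near. Qed.

Lemma integrable_std_normal_pdf :
  lam.-integrable setT (fun x => (@std_normal_pdf R m x)%:E) /\
  (\int[lam]_x (@std_normal_pdf R m x)%:E = 1)%E.
Proof.
set r := Num.sqrt (2 * pi) ^+ m : R.
have r0 : 0 < r by rewrite exprn_gt0// sqrtr_gt0 mulr_gt0// pi_gt0.
have mphi : measurable_fun setT (@std_normal_pdf R m).
  apply: measurable_funM => //; apply: measurableT_comp => //.
  by apply: measurable_funM => //; apply: measurableT_comp => //; exact: measurable_dot.
have one : (\int[lam]_x (@std_normal_pdf R m x)%:E = 1)%E.
  rewrite /std_normal_pdf; under eq_integral do rewrite EFinM.
  rewrite ge0_integralZl//.
  - by rewrite integral_std_gauss -EFinM mulVf// gt_eqF.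
  - apply/measurable_EFinP; apply: measurableT_comp => //; apply: measurable_funM => //.
    by apply: measurableT_comp => //; exact: measurable_dot.
split => //; apply/integrableP; split; first exact/measurable_EFinP.
under eq_integral do rewrite gee0_abs ?lee_fin ?mulr_ge0 ?expR_ge0 ?invr_ge0 ?(ltW r0)//.
by rewrite one ltry.
Qed.

(** A bounded test function is made nonnegative by adding its bound. *)
Lemma posterior_cvg (dT : measure_display) (T : nat -> measurableType dT)
    (Q : forall n, probability (T n) R) (X : forall n, {RV (Q n) >-> 'rV[R]_m})
    (nu : R^nat) :
  (\forall n \near \oo, 0 <= nu n /\
    has_density (X n) D (fun x => (nu n * gibbs f (al n) (be n) x)%:E)) ->
  cvg_in_distribution Q (fun n s => (X n s - a n) *m invmx (S n)) std_normal_pdf.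
Proof.
move=> dens g /continuous_row_measurable mg [B gB].
have [iphi phi1] := integrable_std_normal_pdf.
have mphi : measurable_fun setT (@std_normal_pdf R m).
  exact/measurable_EFinP/measurable_int/iphi.
have phi0 x : 0 <= @std_normal_pdf R m x.
  by rewrite mulr_ge0 ?expR_ge0// invr_ge0 exprn_ge0// sqrtr_ge0.
pose h x := g x + B.
have mh : measurable_fun setT h by exact: measurable_funD.
have hB x : 0 <= h x <= 2 * B.
  by have := gB x; rewrite ler_norml /h => /andP[? ?]; apply/andP; split; lra.
have := posterior_cvg_ge0 dens mh hB.
have -> : (\int[lam]_x (h x * std_normal_pdf x)%:E =
    \int[lam]_x (g x * std_normal_pdf x)%:E + B%:E)%E.
  have iB : lam.-integrable setT (fun x => (B * @std_normal_pdf R m x)%:E).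
    by under eq_fun do rewrite EFinM; exact: integrableZl.
  have ig : lam.-integrable setT (fun x => (g x * @std_normal_pdf R m x)%:E).
    apply: le_integrable iB => //.
      by apply/measurable_EFinP; exact: measurable_funM.
    move=> x _; rewrite lee_fin (normrM (g x)) (normrM B) (ger0_norm (phi0 x)).
    by rewrite ler_wpM2r// (le_trans (gB x))// ler_norm.
  under eq_integral do rewrite /h mulrDl EFinD.
  rewrite integralD//; congr (_ + _)%E.
  by under eq_integral do rewrite EFinM; rewrite integralZl// phi1 mule1.
have QE n : (\int[Q n]_s (h ((X n s - a n) *m invmx (S n)))%:E =
    \int[Q n]_s (g ((X n s - a n) *m invmx (S n)))%:E + B%:E)%E.
  have mZ : measurable_fun setT (fun s => (X n s - a n) *m invmx (S n)).
    by apply: measurable_rowM; apply: measurable_rowB => //; exact: measurable_cst.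
  have mgZ := measurableT_comp mg mZ.
  have iB : (Q n).-integrable setT (fun=> B%:E) by exact: finite_measure_integrable_cst.
  have ig : (Q n).-integrable setT (fun s => (g ((X n s - a n) *m invmx (S n)))%:E).
    apply: le_integrable iB => //; first exact/measurable_EFinP.
    by move=> x _; rewrite lee_fin; exact: le_trans (gB _) (ler_norm _).
  under eq_integral do rewrite /h EFinD.
  rewrite integralD//; congr (_ + _)%E.
  by rewrite integral_cst//= probability_setT mule1.
move=> cvg_h.
have -> : (fun n => \int[Q n]_s (g ((X n s - a n) *m invmx (S n)))%:E)%E =
    (fun n => \int[Q n]_s (h ((X n s - a n) *m invmx (S n)))%:E - B%:E)%E.
  by apply/funext => n; rewrite QE addeK.
rewrite -[X in _ --> X](addeK _ (isT : B%:E \is a fin_num)).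
apply: cvgeB => //; last exact: cvg_cst.
by rewrite fin_num_adde_defl.
Qed.

End asymptotics.

End bernstein_von_mises.

Theorem mainTheorem2 (R : realType) (m d p : nat) (M : vb_model R m d p)
  (openTheta : open (Theta M))
  (base_ge0 : forall x y, 0 <= base M x y)
  (base_meas : measurable_fun setT (fun z => base M z.1 z.2))
  (suff_meas : measurable_fun setT (fun z => suff M z.1 z.2))
  (joint_density1 : forall theta, Theta M theta ->
     (\int[(lebesgue_row d \x lebesgue_row p)%E]_z
        (joint_density M theta z.1 z.2)%:E = 1)%E)
  (psi_C6 : Ck 6 (Theta M) (psi M))
  (hessian_posdef : forall theta, Theta M theta ->
     posdefmx (hessian (psi M) theta))
  (prior_integrable : (lebesgue_row m).-integrable (Theta M)
     (fun t => (conj_kernel M (alpha0 M) (beta0 M) t)%:E))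
  (theta_star : 'rV[R]_m) (Theta_star : Theta M theta_star)
  (dO : measure_display) (Omega : measurableType dO) (P : probability Omega R)
  (Y : nat -> {RV P >-> 'rV[R]_p})
  (Y_density : forall i,
     has_density (Y i) setT (observed_density M theta_star))
  (Y_indep : mutually_independent Y)
  (theta_tilde theta_hat : nat -> Omega -> 'rV[R]_m) :
  let y w := fun i => Y i w in
  let beta_tilde n w := post_beta M (y w) n (theta_tilde n w) in
  let q n w := conj_density M (post_alpha M n) (beta_tilde n w) in
  let Sigma n w :=
    invmx (post_alpha M n *: hessian (psi M) (theta_hat n w)) in
  {ae P, forall w,
     (\forall n \near \oo,
        vb_equilibrium M (y w) n theta_star (theta_tilde n w)) /\
     theta_tilde n w @[n --> \oo] --> theta_star} ->
  {ae P, forall w, \forall n \near \oo,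
     maximises M
       (fun t => dot t (beta_tilde n w) - post_alpha M n * psi M t)
       (theta_hat n w)} ->
  {ae P, forall w,
     forall (dT : measure_display) (T : nat -> measurableType dT)
       (Q : forall n, probability (T n) R)
       (theta : forall n, {RV (Q n) >-> 'rV[R]_m}),
     (\forall n \near \oo,
        has_density (theta n) (Theta M) (fun t => (q n w t)%:E)) ->
     cvg_in_distribution Q
       (fun n s => (theta n s - theta_hat n w) *m invmx (sqrtmx (Sigma n w)))
       std_normal_pdf}.
Proof.
move=> y beta_tilde q Sigma equil modes.
apply: filterS2 equil modes => w [equil tilde_cvg] mode dT T Q theta dens.
have C2 : Ck 2 (Theta M) (psi M) by apply: Ck_le psi_C6.
have mTheta := measurable_row_open openTheta.
have convex := log_partition_convex base_ge0 base_meas suff_meas joint_density1.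
have alpha_oo : post_alpha M n @[n --> \oo] --> +oo.
  apply/cvgryPge => A; near=> n; rewrite /post_alpha -lerBlDr.
  by near: n; exact: nbhs_infty_ger.
pose nu n := conj_norm M (post_alpha M n) (beta_tilde n w).
apply: (@posterior_cvg _ _ _ _ _ openTheta C2 Theta_star hessian_posdef convex
  _ (beta_tilde^~ w) (theta_tilde^~ w) (theta_hat^~ w) alpha_oo tilde_cvg _ _
  _ _ _ _ nu).
- near=> n.
  have [defd fixpoint _] : vb_equilibrium M (y w) n theta_star (theta_tilde n w).
    by near: n.
  have densn : has_density (theta n) (Theta M) (fun t => (q n w t)%:E) by near: n.
  have [_ _ [iK ixK] _] := defd.
  split => // j.
  (* a zero integral would give the zero density, which is not a probability *)
  have K_neq0 : \int[lebesgue_row m]_(t in Theta M)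
      conj_kernel M (post_alpha M n) (beta_tilde n w) t != 0.
    apply/eqP => K0.
    have := densn setT measurableT; rewrite probability_setT setIT.
    rewrite integral0_eq => [/eqP|t _]; first by rewrite onee_eq0.
    by rewrite /q /conj_density /conj_norm K0 invr0 mul0r.
  have := congr1 (fun t : 'rV[R]_m => t ord0 j) fixpoint.
  rewrite mxE -/(beta_tilde n w) => <-.
  under [X in _ = X * _]eq_Rintegral do rewrite /conj_density mulrCA.
  rewrite RintegralZl//; last exact: ixK.
  by rewrite /conj_norm mulrAC mulVf// mul1r.
- near=> n.
  have [Th hmax] : maximises M
      (fun t => dot t (beta_tilde n w) - post_alpha M n * psi M t) (theta_hat n w).
    by near: n.
  by split => // x Tx; rewrite ler_expR; exact: hmax.
- apply: filterS dens => n densn; split => //.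
  by rewrite invr_ge0; apply: Rintegral_ge0 => t _; exact: expR_ge0.
Unshelve. all: by end_near. Qed.
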